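(* Let $G$ be a finitely generated one-ended group that splits non-trivially over a two-ended group $C$, i.e. $G$ is either an amalgam $G=A*_CB$ with $C\neq A$ and $C\neq B$, or an HNN extension $G=A*_C$, where $C$ is two-ended. Let $G\curvearrowright T$ be the action on the corresponding Bass--Serre tree. Then the halfspaces of $G\curvearrowright T$ are one-ended.
   Context: For an edge $e$ of a tree $T$ with midpoint $\hat e$, a halfspace of $T$ bounded by $\hat e$ is the union of $\hat e$ with one of the two components of $T-\hat e$. Halfspaces of a splitting: let a finitely generated group $G$ act on a simplicial tree $T$ without edge inversions, minimally (no proper invariant subtree), and with finitely generated edge stabilizers. Fix an orbit map $f:G\to VT$, $f(g)=gv$, and a finite generating set $S$ of $G$ such that for every halfspace $\mathfrak h$ of $T$ the induced subgraph of $f^{-1}(\mathfrak h)$ in the Cayley graph $\mathrm{Cay}(G,S)$ is connected (such $S$ exists). These induced subgraphs, with their induced path metrics, are the halfspaces of $G\curvearrowright T$. Up to quasi-isometry they do not depend on $f$ and $S$, so one-endedness of halfspaces is well-defined. A connected locally finite graph is one-ended if it is infinite and for every finite subgraph $K$ the complement of $K$ has exactly one unbounded component. The ends of a finitely generated group are those of any of its Cayley graphs with respect to finite generating sets. *)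

(* Defs.v *)
From HB Require Import structures.
From mathcomp Require Import all_boot.
From mathcomp Require Import boolp classical_sets functions cardinality.
Set Implicit Arguments.
Unset Strict Implicit.
Unset Printing Implicit Defensive.
Local Open Scope classical_set_scope.
Local Open Scope group_scope.

(** * Graphs *)

(* Loops and multiple edges are allowed, as in Serre; the orientation of edges
   is only a way to name their endpoints. *)
Record graph := Graph {
  vertex : Type;
  edge : Type;
  src : edge -> vertex;
  tgt : edge -> vertex }.

Section Graphs.
Variable X : graph.
Implicit Types (x y z : vertex X) (e : edge X) (U : set (vertex X)).

Definition adjacent x y : Prop :=
  exists e, (src e = x /\ tgt e = y) \/ (src e = y /\ tgt e = x).

Inductive walk : nat -> vertex X -> vertex X -> Prop :=
| walk_nil x : walk 0 x x
| walk_cons n x y z : adjacent x y -> walk n y z -> walk n.+1 x z.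

Definition joined x y : Prop := exists n, walk n x y.

Definition connected_graph : Prop := forall x y, joined x y.

Definition component U : Prop := exists x, U = [set y | joined x y].

(* Finite diameter for the path metric of [X]. *)
Definition bounded U : Prop :=
  exists n, forall x y, U x -> U y -> exists2 m, (m <= n)%N & walk m x y.

Definition locally_finite : Prop :=
  forall x, finite_set [set e | src e = x \/ tgt e = x].

End Graphs.

Section Subgraphs.
Variable X : graph.
Implicit Types (e : edge X) (U : set (vertex X)).

Definition induced U : graph :=
  @Graph {x | U x} {e | U (src e) /\ U (tgt e)}
    (fun f => exist _ (src (sval f)) (svalP f).1)
    (fun f => exist _ (tgt (sval f)) (svalP f).2).

(* [X] minus the open edge [e]. *)
Definition delete_edge e : graph :=
  @Graph (vertex X) {f : edge X | f <> e}
    (fun f => src (sval f)) (fun f => tgt (sval f)).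

(* The vertex set of a halfspace bounded by the midpoint of [e]. *)
Definition halfspace e U : Prop := @component (delete_edge e) U.

(* The unbounded components of the complement of a finite subgraph depend only
   on its vertex set [K]: an edge which joins two vertices of [K] without
   belonging to the subgraph is a bounded component.  Boundedness is meant in
   the metric of [X]. *)
Definition unbounded_component (K : set (vertex X))
    (U : set (vertex (induced (~` K)))) : Prop :=
  component U /\ ~ bounded (X := X) [set sval u | u in U].

End Subgraphs.

Definition one_ended (X : graph) : Prop :=
  [/\ connected_graph X, locally_finite X, infinite_set [set: vertex X] &
      forall K : set (vertex X), finite_set K ->
        exists! U, unbounded_component (K := K) U].

(* The number of ends is the supremum over [K] of the number of unbounded
   components of the complement of [K]; here it is exactly 2. *)
Definition two_ended (X : graph) : Prop :=
  [/\ connected_graph X, locally_finite X,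
      forall K : set (vertex X), finite_set K -> forall U1 U2 U3,
        unbounded_component (K := K) U1 -> unbounded_component (K := K) U2 ->
        unbounded_component (K := K) U3 -> [\/ U1 = U2, U1 = U3 | U2 = U3] &
      exists K : set (vertex X), finite_set K /\
        exists U1 U2, [/\ unbounded_component (K := K) U1,
                          unbounded_component (K := K) U2 & U1 <> U2]].

(** * Groups *)

Definition is_subgroup (G : groupType) (H : set G) : Prop :=
  [/\ H 1, forall x y, H x -> H y -> H (x * y) & forall x, H x -> H x^-1].

Definition generates (G : groupType) (S : set G) : Prop :=
  forall H : set G, is_subgroup H -> S `<=` H -> H = [set: G].

(* Right Cayley graph: [G] acts on it by left multiplication. *)
Definition cayley (G : groupType) (S : set G) : graph :=
  @Graph G (G * {s | S s}) (fun e => e.1) (fun e => e.1 * sval e.2).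

(* Finite generation is included; the number of ends does not depend on [S]. *)
Definition one_ended_group (G : groupType) : Prop :=
  exists S : set G, [/\ finite_set S, generates S & one_ended (cayley S)].

Definition two_ended_group (G : groupType) : Prop :=
  exists S : set G, [/\ finite_set S, generates S & two_ended (cayley S)].

(** * Group actions on graphs *)

(* The action preserves the orientation, so there are no edge inversions. *)
Record graph_action (G : groupType) := GraphAction {
  space :> graph;
  vact : G -> vertex space -> vertex space;
  eact : G -> edge space -> edge space;
  vact1 : forall x, vact 1 x = x;
  vactM : forall g h x, vact (g * h) x = vact g (vact h x);
  eact1 : forall e, eact 1 e = e;
  eactM : forall g h e, eact (g * h) e = eact g (eact h e);
  src_eact : forall g e, src (eact g e) = vact g (src e);
  tgt_eact : forall g e, tgt (eact g e) = vact g (tgt e) }.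

Section Halfspaces.
Variables (G : groupType) (T : graph_action G) (v : vertex T) (S : set G).

(* The halfspace of the splitting defined by [h], for the orbit map
   [g |-> g v] and the generating set [S]. *)
Definition group_halfspace (h : set (vertex T)) : graph :=
  @induced (cayley S) [set g : G | h (vact g v)].

Definition admissible_generators : Prop :=
  [/\ finite_set S, generates S &
      forall (e : edge T) (h : set (vertex T)), halfspace e h ->
        connected_graph (group_halfspace h)].

End Halfspaces.

Definition one_ended_halfspaces (G : groupType) (T : graph_action G) : Prop :=
  forall (v : vertex T) (S : set G), admissible_generators v S ->
  forall (e : edge T) (h : set (vertex T)), halfspace e h ->
    one_ended (group_halfspace v S h).

(** * Splittings *)

(* [G] is the pushout of two injections of [C], neither of them onto. *)
Record amalgam (G C : groupType) := Amalgam {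
  am_A : groupType;
  am_B : groupType;
  am_CA : {multiplicative C -> am_A};
  am_CB : {multiplicative C -> am_B};
  am_inA : {multiplicative am_A -> G};
  am_inB : {multiplicative am_B -> G};
  am_CA_inj : injective am_CA;
  am_CB_inj : injective am_CB;
  am_comm : forall c, am_inA (am_CA c) = am_inB (am_CB c);
  am_exists : forall (H : groupType) (f : {multiplicative am_A -> H})
      (g : {multiplicative am_B -> H}),
    (forall c, f (am_CA c) = g (am_CB c)) ->
    exists phi : {multiplicative G -> H},
      (forall a, phi (am_inA a) = f a) /\ (forall b, phi (am_inB b) = g b);
  am_unique : forall (H : groupType) (phi psi : {multiplicative G -> H}),
    (forall a, phi (am_inA a) = psi (am_inA a)) ->
    (forall b, phi (am_inB b) = psi (am_inB b)) -> phi =1 psi;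
  am_CA_proper : range am_CA <> [set: am_A];
  am_CB_proper : range am_CB <> [set: am_B] }.

(* [G] is universal among the groups under [A] with an element [t] such that
   [t * beta c * t^-1 = alpha c], where [alpha] and [beta] are the two
   injections of [C] into [A]. *)
Record hnn (G C : groupType) := Hnn {
  hnn_A : groupType;
  hnn_alpha : {multiplicative C -> hnn_A};
  hnn_beta : {multiplicative C -> hnn_A};
  hnn_in : {multiplicative hnn_A -> G};
  hnn_t : G;
  hnn_alpha_inj : injective hnn_alpha;
  hnn_beta_inj : injective hnn_beta;
  hnn_comm : forall c,
    hnn_t * hnn_in (hnn_beta c) * hnn_t^-1 = hnn_in (hnn_alpha c);
  hnn_exists : forall (H : groupType) (f : {multiplicative hnn_A -> H}) (s : H),
    (forall c, s * f (hnn_beta c) * s^-1 = f (hnn_alpha c)) ->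
    exists phi : {multiplicative G -> H},
      (forall a, phi (hnn_in a) = f a) /\ phi hnn_t = s;
  hnn_unique : forall (H : groupType) (phi psi : {multiplicative G -> H}),
    (forall a, phi (hnn_in a) = psi (hnn_in a)) -> phi hnn_t = psi hnn_t ->
    phi =1 psi }.

Inductive splitting (G C : groupType) :=
| AmalgamSplitting of amalgam G C
| HnnSplitting of hnn G C.

(** * Bass-Serre trees *)

(* These are only defined as graphs with an action; that they are trees is the
   theorem of Bass and Serre. *)

Section Cosets.
Variable G : groupType.
Implicit Types (g h t : G) (H K P : set G).

Definition translate g P : set G := [set g * x | x in P].

Definition mulset P Q : set G := [set x * y | x in P & y in Q].

Definition coset H : Type := {P : set G | exists g, P = translate g H}.

Lemma translate1 P : translate 1 P = P.
Proof.
rewrite /translate -[RHS]image_id; apply: eq_imagel => x _; exact: mul1g.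
Qed.

Lemma translateM g h P : translate (g * h) P = translate g (translate h P).
Proof.
by rewrite /translate image_comp; apply: eq_imagel => x _ /=; rewrite mulgA.
Qed.

Lemma mulset_translate g P Q : mulset (translate g P) Q = translate g (mulset P Q).
Proof.
apply/seteqP; split => [_ [_ [x Px <-] [y Qy <-]]|_ [_ [x Px [y Qy <-]] <-]].
  by exists (x * y); [exists x => //; exists y | rewrite mulgA].
by exists (g * x); [exists x | exists y => //; rewrite mulgA].
Qed.

Lemma coset_act_subproof H g (P : coset H) :
  exists h, translate g (sval P) = translate h H.
Proof. by have [h Ph] := svalP P; exists (g * h); rewrite Ph translateM. Qed.

Definition coset_act H g (P : coset H) : coset H :=
  exist _ (translate g (sval P)) (coset_act_subproof g P).

Lemma coset_inj H (P Q : coset H) : sval P = sval Q -> P = Q.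
Proof. by case: P Q => [P hP] [Q hQ] /= PQ; exact: eq_exist. Qed.

Lemma coset_act1 H (P : coset H) : coset_act 1 P = P.
Proof. by apply: coset_inj; rewrite /= translate1. Qed.

Lemma coset_actM H g h (P : coset H) :
  coset_act (g * h) P = coset_act g (coset_act h P).
Proof. by apply: coset_inj; rewrite /= translateM. Qed.

Lemma coset_map_subproof H K t (HtK : mulset H (translate t K) = translate t K)
  (P : coset H) : exists g, mulset (sval P) (translate t K) = translate g K.
Proof.
by have [h Ph] := svalP P; exists (h * t); rewrite Ph mulset_translate HtK translateM.
Qed.

(* The map [gH |-> gtK], defined when [HtK = tK]. *)
Definition coset_map H K t (HtK : mulset H (translate t K) = translate t K)
    (P : coset H) : coset K :=
  exist _ (mulset (sval P) (translate t K)) (coset_map_subproof HtK P).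

Lemma coset_map_act H K t (HtK : mulset H (translate t K) = translate t K)
  g (P : coset H) : coset_map HtK (coset_act g P) = coset_act g (coset_map HtK P).
Proof. by apply: coset_inj; rewrite /= mulset_translate. Qed.

Lemma mulset_absorb (A C : groupType) (i : {multiplicative A -> G})
    (j : C -> G) (k : {multiplicative C -> A}) t :
  (forall c, j c * t = t * i (k c)) ->
  mulset (range j) (translate t (range i)) = translate t (range i).
Proof.
move=> jt; apply/seteqP; split.
  move=> _ [_ [c _ <-] [_ [_ [a _ <-] <-] <-]].
  by exists (i (k c * a)); [exists (k c * a) | rewrite gmulfM !mulgA jt].
move=> _ [_ [a _ <-] <-]; exists (j 1); first by exists 1.
exists (t * i ((k 1)^-1 * a)).
  by exists (i ((k 1)^-1 * a)) => //; exists ((k 1)^-1 * a).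
by rewrite mulgA jt -mulgA -gmulfM mulgA mulgV mul1g.
Qed.

End Cosets.

Section AmalgamTree.
Variables (G C : groupType) (s : amalgam G C).

Let A : set G := range (am_inA s).
Let B : set G := range (am_inB s).
Let C' : set G := range (am_inA s \o am_CA s).

Lemma amalgam_absorbA : mulset C' (translate 1 A) = translate 1 A.
Proof.
by apply: (mulset_absorb (k := am_CA s)) => c; rewrite /= mulg1 mul1g.
Qed.

Lemma amalgam_absorbB : mulset C' (translate 1 B) = translate 1 B.
Proof.
by apply: (mulset_absorb (k := am_CB s)) => c; rewrite /= mulg1 mul1g am_comm.
Qed.

(* Vertices [G/A + G/B]; the edge [gC] joins [gA] to [gB]. *)
Definition amalgam_graph : graph :=
  @Graph (coset A + coset B) (coset C')
    (fun e => inl (coset_map amalgam_absorbA e))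
    (fun e => inr (coset_map amalgam_absorbB e)).

Definition amalgam_vact (g : G) (x : coset A + coset B) : coset A + coset B :=
  match x with inl P => inl (coset_act g P) | inr P => inr (coset_act g P) end.

Definition amalgam_tree : graph_action G.
Proof.
apply: (@GraphAction G amalgam_graph amalgam_vact (@coset_act G C')).
- by case=> P /=; rewrite coset_act1.
- by move=> g h [] P /=; rewrite coset_actM.
- exact: coset_act1.
- exact: coset_actM.
- by move=> g e /=; rewrite coset_map_act.
- by move=> g e /=; rewrite coset_map_act.
Defined.

End AmalgamTree.

Section HnnTree.
Variables (G C : groupType) (s : hnn G C).

Let A : set G := range (hnn_in s).
Let C' : set G := range (hnn_in s \o hnn_alpha s).

Lemma hnn_absorb_src : mulset C' (translate 1 A) = translate 1 A.
Proof.
by apply: (mulset_absorb (k := hnn_alpha s)) => c; rewrite /= mulg1 mul1g.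
Qed.

Lemma hnn_absorb_tgt : mulset C' (translate (hnn_t s) A) = translate (hnn_t s) A.
Proof.
by apply: (mulset_absorb (k := hnn_beta s)) => c; rewrite /= -hnn_comm mulgVK.
Qed.

(* Vertices [G/A]; the edge [g alpha(C)] joins [gA] to [gtA]. *)
Definition hnn_graph : graph :=
  @Graph (coset A) (coset C')
    (coset_map hnn_absorb_src) (coset_map hnn_absorb_tgt).

Definition hnn_tree : graph_action G.
Proof.
apply: (@GraphAction G hnn_graph (@coset_act G A) (@coset_act G C')).
- exact: coset_act1.
- exact: coset_actM.
- exact: coset_act1.
- exact: coset_actM.
- by move=> g e /=; rewrite coset_map_act.
- by move=> g e /=; rewrite coset_map_act.
Defined.

End HnnTree.

Definition bass_serre_tree (G C : groupType) (s : splitting G C) : graph_action G :=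
  match s with
  | AmalgamSplitting a => amalgam_tree a
  | HnnSplitting h => hnn_tree h
  end.

(* Main.v *)
Require Import Defs.
From HB Require Import structures.
From mathcomp Require Import all_boot.
From mathcomp Require Import boolp classical_sets functions cardinality.
Set Implicit Arguments.
Unset Strict Implicit.
Unset Printing Implicit Defensive.
Local Open Scope classical_set_scope.
Local Open Scope group_scope.

(* Let [H] be the set of the [g] with [g v] in a halfspace [h] bounded by [e], and
   let [C] be the stabilizer of [e].  The frontier of [H] lies in finitely many
   [C]-orbits, whereas neither [H] nor its complement does, since some element
   of [G] maps [h] properly into itself.  Let [E] be a subset of [H] with
   finite coboundary in [H], and suppose that [E] and [H \ E] are infinite.  As [G]
   is one-ended, neither can be finite on every [C]-orbit, so [E] cuts [C] into
   its two ends.  Some [z] in [C] then moves [E] properly into itself, up to taking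
   inverses; the difference of [E] and its translate is finite on [C]-orbits, hence
   finite by one-endedness of [G], and its translates by the powers of [z] cover
   [H].  So [H] lies in finitely many [C]-orbits, a contradiction.

   That an edge separates the Bass-Serre graph, and that the vertex groups embed,
   is obtained from the universal property of [G], applied to the semidirect
   product of [G] with [G -> bool] and to a group of bijections. *)

(** * Finite sets *)

Lemma finite_preimage_inj (T U : Type) (f : T -> U) (B : set U) :
  injective f -> finite_set B -> finite_set [set x | B (f x)].
Proof.
by move=> fI; apply: finite_preimage => x y _ _; exact: fI.
Qed.

Lemma finite_uniform_bound (T : Type) (A : set T) (P : nat -> T -> Prop) :
  finite_set A -> (forall x, A x -> exists n, P n x) ->
  exists N, forall x, A x -> exists2 n, (n <= N)%N & P n x.
Proof.
move=> finA exP.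
have /choice [f fP] : forall x, exists n, A x -> P n x.
  move=> x; have [/exP[n Pn]|nAx] := pselect (A x); first by exists n.
  by exists 0.
have /finite_seqP[s fAs] := finite_image f finA.
exists (\max_(n <- s) n) => x Ax; exists (f x); last exact: fP.
have : [set` s] (f x) by rewrite -fAs; exists x.
by move=> /= fxs; rewrite (big_rem _ fxs) /= leq_maxl.
Qed.

(** * Paths and components *)

Section Paths.
Variable X : graph.
Implicit Types (x y z : vertex X) (U V K : set (vertex X)).

(** Walks of the induced subgraph on [U], expressed in [X] itself so that no vertices of a subtype
    occur. *)
Inductive path_in U : vertex X -> vertex X -> Prop :=
| path_in_nil x : U x -> path_in U x x
| path_in_cons x y z : U x -> adjacent x y -> path_in U y z -> path_in U x z.

Lemma adjacentC x y : adjacent x y -> adjacent y x.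
Proof. by case=> e [] h; exists e; [right|left]. Qed.

Lemma path_in_src U x y : path_in U x y -> U x.
Proof. by case. Qed.

Lemma path_in_tgt U x y : path_in U x y -> U y.
Proof. by elim. Qed.

Lemma path_in_trans U x y z : path_in U x y -> path_in U y z -> path_in U x z.
Proof. by elim=> // {}x y' {}y Ux xy' _ IH /IH; exact: path_in_cons. Qed.

Lemma path_in_step U x y : U x -> U y -> adjacent x y -> path_in U x y.
Proof. by move=> Ux Uy xy; apply: (path_in_cons Ux xy); exact: path_in_nil. Qed.

Lemma path_in_sym U x y : path_in U x y -> path_in U y x.
Proof.
elim=> [{}x Ux|{}x y' {}y Ux xy' p IH]; first exact: path_in_nil.
apply: path_in_trans IH _; apply: path_in_step => //; last exact: adjacentC.
exact: path_in_src p.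
Qed.

Lemma path_in_closed U V x y :
  (forall z w, V z -> U z -> U w -> adjacent z w -> V w) ->
  path_in U x y -> V x -> V y.
Proof.
move=> closedV; elim=> // {}x y' {}y Ux xy' p IH Vx; apply: IH.
exact: closedV (path_in_src p) xy'.
Qed.

Lemma joinedP x y : joined x y <-> path_in setT x y.
Proof.
split=> [[n]|].
  by elim=> [z|m z w t zw _ IH]; [exact: path_in_nil|exact: path_in_cons zw IH].
elim=> [z _|z w t _ zw _ [n wn]]; first by exists 0; exact: walk_nil.
by exists n.+1; exact: walk_cons zw wn.
Qed.

End Paths.

Section Components.
Variable X : graph.
Implicit Types (x y z : vertex X) (U V K : set (vertex X)).

Lemma adjacent_inducedP U (a b : vertex (induced U)) :
  adjacent a b <-> adjacent (sval a) (sval b).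
Proof.
split=> [[e ed]|[e ed]].
  by exists (sval e); case: ed => -[<- <-]; [left|right].
have Ue : U (src e) /\ U (tgt e).
  by case: ed => -[-> ->]; split; apply: svalP.
exists (exist _ e Ue).
case: a b ed => [c Uc] [d Ud] /= [] [ec ed]; [left|right];
  by split; apply: eq_exist.
Qed.

Lemma locally_finite_induced U :
  locally_finite X -> locally_finite (induced U).
Proof.
move=> lfX a.
have fI : injective (fun e : edge (induced U) => sval e).
  by move=> [e Ue] [f Uf] /= ef; exact: eq_exist.
apply: sub_finite_set (finite_preimage_inj fI (lfX (sval a))) => -[e Ue] /=.
by case=> <-; [left|right].
Qed.

Lemma joined_inducedP U (a b : vertex (induced U)) :
  joined a b <-> path_in U (sval a) (sval b).
Proof.
rewrite joinedP; split.
  elim=> [c _|c d f _ /adjacent_inducedP cd _ IH]; first by apply: path_in_nil; apply: svalP.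
  by apply: path_in_cons cd IH; apply: svalP.
move: a b => [a Ua] [b Ub] /= ab; elim: ab Ua Ub => {a b}.
  by move=> x _ Ua Ub; rewrite (Prop_irrelevance Ua Ub); exact: path_in_nil.
move=> x y z Ux xy yz IH Ua Ub.
have Uy := path_in_src yz.
apply: (@path_in_cons (induced U) setT _ (exist _ y Uy)) (IH Uy Ub) => //.
exact/adjacent_inducedP.
Qed.

Lemma connected_inducedP U :
  connected_graph (induced U) <-> forall x y, U x -> U y -> path_in U x y.
Proof.
split=> [conn x y Ux Uy|conn a b].
  by have /joined_inducedP := conn (exist _ x Ux) (exist _ y Uy).
by apply/joined_inducedP; apply: conn; apply: svalP.
Qed.

(** A path from [x] that meets [K] is stopped at its first vertex [k] in [K], and [z] is the vertex
    just before. *)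
Lemma path_in_avoid K x y : joined x y -> ~ K x -> ~ K y ->
  path_in (~` K) x y \/
  exists k z, [/\ K k, adjacent k z & path_in (~` K) x z].
Proof.
move=> /joinedP; elim=> [z|z w t _ zw p IH] NKz NKt.
  by left; exact: path_in_nil.
have [Kw|NKw] := pselect (K w).
  right; exists w, z; split=> //; first exact: adjacentC.
  exact: path_in_nil.
have [p'|[k [u [Kk ku p']]]] := IH NKw NKt.
  by left; exact: path_in_cons zw p'.
by right; exists k, u; split=> //; exact: path_in_cons zw p'.
Qed.

Hypotheses (conX : connected_graph X) (lfX : locally_finite X).

Lemma finite_adjacent x : finite_set [set y | adjacent x y].
Proof.
apply: (@sub_finite_set _ _
  ((@src X) @` [set e | src e = x \/ tgt e = x] `|`
   (@tgt X) @` [set e | src e = x \/ tgt e = x])).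
  by move=> y [e [[ex ey]|[ey ex]]]; [right|left]; exists e => //=; [left|right].
by rewrite finite_setU; split; apply: finite_image; exact: lfX.
Qed.

Lemma finite_walk n x : finite_set [set y | walk n x y].
Proof.
elim: n x => [|n IH] x.
  apply: (sub_finite_set _ (finite_set1 x)) => y /= w.
  by inversion w; subst.
apply: (@sub_finite_set _ _
  (\bigcup_(z in [set z | adjacent x z]) [set y | walk n z y])).
  by move=> y /= w; inversion w; subst; exists y0.
by apply: bigcup_finite => [|z _]; [exact: finite_adjacent|exact: IH].
Qed.

(** Balls of a locally finite graph are finite; conversely, finitely many pairs of vertices need
    walks of bounded length only. *)
Lemma boundedP U : bounded U <-> finite_set U.
Proof.
split=> [[n nU]|finU].
  have [->|/set0P[x Ux]] := eqVneq U set0; first exact: finite_set0.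
  apply: (@sub_finite_set _ _ (\bigcup_(m in `I_n.+1) [set y | walk m x y])).
    by move=> y Uy; have [m mn w] := nU _ _ Ux Uy; exists m.
  by apply: bigcup_finite => // m _; exact: finite_walk.
have [|N Nb] := @finite_uniform_bound _ (U `*` U)
  (fun n p => walk n p.1 p.2) (finite_setX finU finU).
  by move=> [x y] _; exact: conX.
by exists N => x y Ux Uy; exact: (Nb (x, y)).
Qed.

Lemma image_sval_component K (a : vertex (induced (~` K))) :
  [set sval u | u in [set b | joined a b]] = path_in (~` K) (sval a).
Proof.
apply/seteqP; split=> [_ [b /joined_inducedP ab <-]//|y ay].
by exists (exist _ y (path_in_tgt ay)) => //; apply/joined_inducedP.
Qed.

(** Every component of the complement of [K] meets the finite set [N] of neighbours of [K] and one
    base point [x0]. So [W] outside [K] is a union of finitely many components, one of which is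
    infinite. *)
Lemma infinite_closed_component K W : finite_set K -> infinite_set W ->
  (forall x y, W x -> ~ K x -> ~ K y -> adjacent x y -> W y) ->
  exists U : set (vertex (induced (~` K))),
    [/\ unbounded_component U, U !=set0 &
    forall u, U u -> W (sval u)].
Proof.
move=> finK infW closedW.
have closedW' x y : path_in (~` K) x y -> W x -> W y.
  by apply: path_in_closed => z w; exact: closedW.
have [x0 [Wx0 NKx0]] : W `\` K !=set0 by apply: infinite_setN0; exact: infinite_setD.
pose N := x0 |` \bigcup_(k in K) [set y | adjacent k y].
have finN : finite_set N.
  rewrite finite_setU; split; first exact: finite_set1.
  by apply: bigcup_finite => // k _; exact: finite_adjacent.
have coverW x : ~ K x -> exists2 y, N y & path_in (~` K) x y.
  move=> NKx; have [p|[k [y [Kk ky p]]]] := path_in_avoid (conX x x0) NKx NKx0.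
    by exists x0 => //; left.
  by exists y => //; right; exists k.
have [y [Ny NKy infy Wy]] : exists y, [/\ N y, ~ K y,
    infinite_set (path_in (~` K) y) & W y].
  apply: contrapT => noy; apply: (infinite_setD infW finK).
  apply: (@sub_finite_set _ _
    (\bigcup_(y in N `&` W `\` K) path_in (~` K) y)).
    move=> x [Wx NKx]; have [y Ny xy] := coverW x NKx.
    exists y; last exact: path_in_sym.
    split; last exact: path_in_tgt xy.
    by split=> //; exact: closedW' xy Wx.
  apply: bigcup_finite => [|y [[Ny Wy] NKy]].
    by apply: finite_setD; exact: finite_setIl.
  by apply: contrapT => infy; apply: noy; exists y.
pose a : vertex (induced (~` K)) := exist _ y NKy.
exists [set b | joined a b]; split.
- split; first by exists a.
  by rewrite image_sval_component => /boundedP.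
- by exists a; apply/joined_inducedP; exact: path_in_nil.
- by move=> u /joined_inducedP /closedW'; exact.
Qed.

Lemma unbounded_component_infinite K (U : set (vertex (induced (~` K)))) :
  unbounded_component U ->
  exists x, [/\ ~ K x, infinite_set (path_in (~` K) x) &
    U = [set b | path_in (~` K) x (sval b)]].
Proof.
move=> [[a ->] unb]; exists (sval a); split.
- exact: (svalP a).
- by rewrite -image_sval_component => /boundedP.
- by apply/seteqP; split=> b /joined_inducedP.
Qed.

End Components.

(** * Almost invariant sets *)

Section AlmostInvariant.
Variable G : groupType.
Implicit Types (P Q S : set G) (x y g : G).

(** Right translations move along the edges of the right Cayley graph. For finitely generated [G]
    these are the sets with finite coboundary, described without choosing generators. *)
Definition almost_invariant P :=
  forall g, finite_set [set x | P x <> P (x * g)].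

Lemma finite_mulg_preimage P g : finite_set P -> finite_set [set x | P (x * g)].
Proof. by apply: finite_preimage_inj; exact: mulIg. Qed.

(** The elements [g] whose right translation changes [P] at finitely many points form a subgroup. *)
Lemma almost_invariant_generates S P : generates S ->
  (forall s, S s -> finite_set [set x | P x <> P (x * s)]) ->
  almost_invariant P.
Proof.
move=> genS finS g; pose H := [set g | finite_set [set x | P x <> P (x * g)]].
suff HT : H = [set: G] by have : H g by rewrite HT.
apply: genS => //; rewrite /H; split=> /=.
- by apply: (sub_finite_set _ (finite_set0 G)) => x /=; rewrite mulg1.
- move=> a b fa fb; have fb' := finite_mulg_preimage a fb.
  have /sub_finite_set : [set x | P x <> P (x * (a * b))] `<=`
    [set x | P x <> P (x * a)] `|` [set x | P (x * a) <> P (x * a * b)].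
    move=> x /= Px; have [Pxa|] := pselect (P x = P (x * a)); last by left.
    by right; rewrite -Pxa -mulgA.
  by apply; rewrite finite_setU; split.
- move=> a fa; apply: (sub_finite_set _ (finite_mulg_preimage a^-1 fa)).
  by move=> x /=; rewrite mulgVK => /nesym.
Qed.

Lemma almost_invariantC P : almost_invariant P -> almost_invariant (~` P).
Proof.
move=> aiP g; apply: (sub_finite_set _ (aiP g)) => x /=.
by apply: contra_not; rewrite /setC /mkset /= => ->.
Qed.

Lemma almost_invariantI P Q :
  almost_invariant P -> almost_invariant Q -> almost_invariant (P `&` Q).
Proof.
move=> aiP aiQ g; apply: (@sub_finite_set _ _
  ([set x | P x <> P (x * g)] `|` [set x | Q x <> Q (x * g)])).
  move=> x /= PQ; have [Px|] := pselect (P x = P (x * g)); last by left.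
  by right; apply: contra_not PQ; rewrite /setI /mkset Px => ->.
by rewrite finite_setU; split.
Qed.

Lemma almost_invariant_translate P g :
  almost_invariant P -> almost_invariant [set x | P (g * x)].
Proof.
move=> aiP h; have := finite_preimage_inj (@mulgI _ g) (aiP h).
by apply: sub_finite_set => x /=; rewrite mulgA.
Qed.

Lemma adjacent_cayley S x y :
  adjacent (X := cayley S) x y <-> exists2 s, S s & y = x * s \/ x = y * s.
Proof.
split=> [[[z [s Ss]]] /= [] [<- <-]|[s Ss xy]].
- by exists s => //; left.
- by exists s => //; right.
case: xy => ->.
  by exists (x, exist _ s Ss); left.
by exists (y, exist _ s Ss); right.
Qed.

Lemma locally_finite_cayley S : finite_set S -> locally_finite (cayley S).
Proof.
move=> finS x.
have fI : injective (fun e : edge (cayley S) => (e.1, sval e.2)).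
  move=> [y [s Ss]] [z [t St]] /= [-> st]; congr pair; exact: eq_exist.
have fB : finite_set (([set x] `*` S) `|` [set (x * s^-1, s) | s in S]).
  rewrite finite_setU; split; last exact: finite_image.
  by apply: finite_setX => //; exact: finite_set1.
apply: (sub_finite_set _ (finite_preimage_inj fI fB)).
move=> [y [s Ss]] /= [->|ys]; first by left.
by right; exists s => //; rewrite -ys mulgK.
Qed.

Definition coboundary S P : set G :=
  [set x | exists2 y, adjacent (X := cayley S) x y & P x <> P y].

Lemma finite_coboundary S P :
  finite_set S -> almost_invariant P -> finite_set (coboundary S P).
Proof.
move=> finS aiP; apply: (@sub_finite_set _ _
  (\bigcup_(s in S) [set x | P x <> P (x * s)] `|`
   \bigcup_(s in S) [set x | P x <> P (x * s^-1)])).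
  move=> x [y /adjacent_cayley[s Ss [->|xys]] Pxy]; [left|right]; exists s => //.
  by rewrite /= xys mulgK -xys.
by rewrite finite_setU; split; apply: bigcup_finite => // s _; exact: aiP.
Qed.

Lemma almost_invariant_component S P K : finite_set S ->
  connected_graph (cayley S) -> finite_set K -> coboundary S P `<=` K ->
  infinite_set P ->
  exists U : set (vertex (@induced (cayley S) (~` K))),
    [/\ unbounded_component U, U !=set0 & forall u, U u -> P (sval u)].
Proof.
move=> finS conS finK PK infP; apply: infinite_closed_component => //.
  exact: locally_finite_cayley.
move=> x y Px NKx _ xy; have [<-//|nPxy] := pselect (P x = P y).
by case: NKx; apply: PK; exists y.
Qed.

(** If both [P] and its complement were infinite, each would contain an unbounded component of the
    complement of the finite coboundary of [P]. *)
Lemma one_ended_almost_invariant P : one_ended_group G ->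
  almost_invariant P -> finite_set P \/ finite_set (~` P).
Proof.
move=> [S [finS genS [conS lfS _ uniq]]] aiP.
apply: contrapT => /not_orP[infP infCP].
have fK := finite_coboundary finS aiP.
have [U [unbU [u Uu] UP]] :=
  almost_invariant_component finS conS fK (@subset_refl _ _) infP.
have KC : coboundary S (~` P) `<=` coboundary S P.
  move=> x [y xy Pxy]; exists y => //.
  by apply: contra_not Pxy; rewrite /setC /mkset => ->.
have [V [unbV [w Vw] VP]] := almost_invariant_component finS conS fK KC infCP.
have [W [_ Wuniq]] := uniq _ fK.
by apply: (VP w Vw); apply: UP; rewrite -(Wuniq _ unbU) (Wuniq _ unbV).
Qed.

(** Outside the union [K] of the three coboundaries, three infinite disjoint sets would contain
    three different unbounded components. *)
Lemma two_ended_almost_invariant P Q R : two_ended_group G ->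
  almost_invariant P -> almost_invariant Q -> almost_invariant R ->
  P `&` Q `<=` set0 -> P `&` R `<=` set0 -> Q `&` R `<=` set0 ->
  [\/ finite_set P, finite_set Q | finite_set R].
Proof.
move=> [S [finS genS [conS lfS three _]]] aiP aiQ aiR PQ PR QR.
apply: contrapT => inf3.
have [infP infQ infR] : [/\ infinite_set P, infinite_set Q & infinite_set R].
  by split=> fin; apply: inf3; [apply: Or31|apply: Or32|apply: Or33].
pose K := coboundary S P `|` coboundary S Q `|` coboundary S R.
have fK : finite_set K.
  by rewrite !finite_setU; split; [split|]; exact: finite_coboundary.
have KP : coboundary S P `<=` K by move=> x; left; left.
have KQ : coboundary S Q `<=` K by move=> x; left; right.
have KR : coboundary S R `<=` K by move=> x; right.
have [U [unbU [u Uu] UP]] := almost_invariant_component finS conS fK KP infP.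
have [V [unbV [v Vv] VQ]] := almost_invariant_component finS conS fK KQ infQ.
have [W [unbW [w Ww] WR]] := almost_invariant_component finS conS fK KR infR.
case: (three K fK U V W unbU unbV unbW) => E.
- by apply: (PQ (sval u)); split; [exact: UP|apply: VQ; rewrite -E].
- by apply: (PR (sval u)); split; [exact: UP|apply: WR; rewrite -E].
- by apply: (QR (sval v)); split; [exact: VQ|apply: WR; rewrite -E].
Qed.

End AlmostInvariant.

(** The translation by [c] either preserves the two ends or exchanges them. Of the four
    intersections of [P], [Q] and their complements at most two are infinite; as all four sets are
    infinite, the infinite intersections are opposite ones. *)
Lemma two_ended_translate (C : groupType) (P : set C) c : two_ended_group C ->
  almost_invariant P -> infinite_set P -> infinite_set (~` P) ->
  finite_set [set x | P x <> P (c * x)] \/ finite_set [set x | P x = P (c * x)].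
Proof.
move=> twoC aiP infP infCP; pose Q := [set x | P (c * x)].
have aiQ : almost_invariant Q by exact: almost_invariant_translate.
have infQ R : infinite_set R -> infinite_set [set x | R (c * x)].
  move=> infR finR; apply: infR.
  apply: (sub_finite_set _ (finite_preimage_inj (@mulgI _ c^-1) finR)) => x Rx.
  by rewrite /= mulVKg.
have {infQ} [infQ infCQ] := (infQ _ infP, infQ _ infCP).
have [aiCP aiCQ] := (almost_invariantC aiP, almost_invariantC aiQ).
have split_inf (R R' : set C) : infinite_set R -> finite_set (R `&` R') ->
    infinite_set (R `&` ~` R').
  move=> infR finI finD; apply: infR; rewrite -(setIT R) -(setUv R') setIUr.
  by rewrite finite_setU.
have e1 := almost_invariantI aiP aiQ; have e2 := almost_invariantI aiP aiCQ.
have e3 := almost_invariantI aiCP aiQ; have e4 := almost_invariantI aiCP aiCQ.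
have sp R : R `&` ~` (R : set C) `<=` set0 by rewrite setICr.
have [finb|infb] := pselect (finite_set (P `&` ~` Q)); last first.
  have [fc|infc] := pselect (finite_set (~` P `&` Q)).
    have infa : infinite_set (P `&` Q).
      by move: (split_inf Q (~` P) infQ); rewrite setCK setIC (setIC Q); apply.
    have infd := split_inf _ _ infCP fc.
    by have [] := two_ended_almost_invariant twoC e1 e2 e4 => //;
      move=> x [[? ?] [? ?]].
  right; apply: (@sub_finite_set _ _ ((P `&` Q) `|` (~` P `&` ~` Q))).
    move=> x /= Px; have [p|p] := pselect (P x).
      by left; split => //; rewrite /Q /= -Px.
    by right; split => //; rewrite /Q /= -Px.
  rewrite finite_setU; split.
    by have [] := two_ended_almost_invariant twoC e1 e2 e3 => //;
      move=> x [[? ?] [? ?]].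
  by have [] := two_ended_almost_invariant twoC e2 e3 e4 => //;
    move=> x [[? ?] [? ?]].
have infa : infinite_set (P `&` Q).
  by have := split_inf _ _ infP finb; rewrite setCK.
have infd : infinite_set (~` P `&` ~` Q).
  by move: (split_inf (~` Q) P infCQ); rewrite setIC (setIC (~` Q)); apply.
left; apply: (@sub_finite_set _ _ ((P `&` ~` Q) `|` (~` P `&` Q))).
  move=> x /= Px; have [p|p] := pselect (P x).
    left; split => // q; apply: Px; exact/propext.
  right; split => //; apply: contrapT => q; apply: Px.
  by apply/propext; split.
rewrite finite_setU; split => //.
by have [] := two_ended_almost_invariant twoC e1 e3 e4 => //;
  move=> x [[? ?] [? ?]].
Qed.

(** Either every [c] almost preserves [P], or some [c1] almost exchanges [P] with its complement;
    then for each [c] one of [c] and [c * c1] almost preserves [P]. In both cases finitely many good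
    elements would make [P] finite. *)
Lemma two_ended_translates (C : groupType) (P : set C) : two_ended_group C ->
  almost_invariant P -> infinite_set P -> infinite_set (~` P) ->
  infinite_set [set c | finite_set [set x | P x <> P (c * x)]].
Proof.
move=> twoC aiP infP infCP fgood.
have [[c1 fc1]|noanti] := pselect (exists c, finite_set [set x | P x = P (c * x)]).
- apply: (infP); apply: (@sub_finite_set _ _
    ([set c | finite_set [set x | P x <> P (c * x)]] `|`
     [set c | finite_set [set x | P x <> P (c * c1 * x)]])).
    move=> c _; have [|fc] := two_ended_translate c twoC aiP infP infCP; first by left.
    right => /=; apply: (@sub_finite_set _ _ ([set x | P x = P (c1 * x)] `|`
      [set x | P (c1 * x) = P (c * (c1 * x))])).
      move=> x /= nP; apply: contrapT => /not_orP[n1 n2]; apply: nP.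
      rewrite -mulgA; apply/propext; split=> p.
        apply: contrapT => q; apply: n2; apply/propext; split=> // r.
        by case: n1; apply/propext; split.
      apply: contrapT => q; apply: n2; apply/propext; split=> // _.
      by apply: contrapT => r; case: n1; apply/propext; split.
    rewrite finite_setU; split => //.
    exact: finite_preimage_inj (@mulgI _ c1) fc.
  rewrite finite_setU; split => //.
  exact: (finite_mulg_preimage c1 fgood).
- apply: (infP); apply: sub_finite_set fgood => c _.
  by have [//|fc] := two_ended_translate c twoC aiP infP infCP; case: noanti; exists c.
Qed.

(** * Ends of halfspaces *)

Section RelativeEnds.
Variables (G C : groupType) (j : C -> G) (S H : set G).
Hypotheses (jM : {morph j : c d / c * d}) (jI : injective j).
Hypotheses (oneG : one_ended_group G) (twoC : two_ended_group C).
Hypotheses (finS : finite_set S) (genS : generates S).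

Definition orbits (F : set G) : set G := [set x | exists c f, F f /\ x = j c * f].

(** These hypotheses are what the tree supplies when [H] consists of the [g] with [g v] in a
    halfspace and [j] identifies [C] with the stabilizer of the bounding edge. *)
Hypothesis jH : forall c x, H x -> H (j c * x).
Hypothesis frontierH : forall g, exists2 F, finite_set F &
  [set x | H x <> H (x * g)] `<=` orbits F.
Hypothesis bigH : forall F, finite_set F -> ~ (H `<=` orbits F).
Hypothesis bigCH : forall F, finite_set F -> ~ (~` H `<=` orbits F).
Hypothesis conH : forall x y, H x -> H y -> path_in (X := cayley S) H x y.

Let adj := @adjacent (cayley S).

Definition relative_coboundary (E : set G) : set G :=
  [set x | H x /\ exists y, [/\ H y, adj x y & E x <> E y]].

Lemma morph_1 : j 1 = 1.
Proof. by apply: (@mulgI _ (j 1)); rewrite -jM !mulg1. Qed.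

Lemma morph_V c : j c^-1 = (j c)^-1.
Proof. by apply: (@mulgI _ (j c)); rewrite -jM !mulgV morph_1. Qed.

Lemma adjacent_mull g x y : adj x y -> adj (g * x) (g * y).
Proof.
move=> /adjacent_cayley[s Ss xy]; apply/adjacent_cayley; exists s => //.
by case: xy => ->; rewrite mulgA; [left|right].
Qed.

Lemma morph_mulr_inj x : injective (fun c => j c * x).
Proof. by move=> c d /mulIg /jI. Qed.

Lemma infinite_outside : infinite_set (~` H).
Proof.
move=> fin; apply: (bigCH fin) => x nHx; exists 1, x; split => //.
by rewrite morph_1 mul1g.
Qed.

(** [D] is almost invariant in [G]: inside [H] it changes at its relative coboundary, and the
    frontier of [H] lies in finitely many orbits, on each of which [D] is finite. As [G] is
    one-ended and the complement of [D] contains that of [H], which is infinite, [D] is finite. *)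
Lemma relative_thin_finite D : D `<=` H -> finite_set (relative_coboundary D) ->
  (forall f, finite_set [set c | D (j c * f)]) -> finite_set D.
Proof.
move=> DH finD thinD.
suff aiD : almost_invariant D.
  have [//|finCD] := one_ended_almost_invariant oneG aiD.
  case: infinite_outside; apply: sub_finite_set finCD => x.
  by apply: contra_not; exact: DH.
apply: (almost_invariant_generates genS) => s Ss.
have [F finF FH] := frontierH s.
(* At a frontier point either [x] or [x * s] lies in [D]; the two unions collect these cases. *)
apply: (@sub_finite_set _ _ (relative_coboundary D `|`
  (\bigcup_(f in F) [set j c * f | c in [set c | D (j c * f)]] `|`
   \bigcup_(f in F) [set j c * f | c in [set c | D (j c * (f * s))]]))).
  move=> x /= Dx; have [Hxs|/FH[c [f [Ff xcf]]]] := pselect (H x = H (x * s)).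
    left; have Hx : H x.
      have [/DH//|nDx] := pselect (D x); rewrite Hxs; apply: DH.
      by apply: contrapT => nDxs; apply: Dx; apply/propext; split.
    split => //; exists (x * s); split => //; first by rewrite -Hxs.
    by apply/adjacent_cayley; exists s => //; left.
  right; have [Dxx|nDx] := pselect (D x).
    by left; exists f => //; exists c => //=; rewrite -xcf.
  right; exists f => //; exists c => //=; rewrite mulgA -xcf.
  by apply: contrapT => nDxs; apply: Dx; apply/propext; split.
rewrite !finite_setU; split => //; split; apply: bigcup_finite => // f _;
  exact: finite_image.
Qed.

(** * Traces of a cut on the orbits of [C] *)

Section Cut.
Variable E : set G.
Hypothesis finE : finite_set (relative_coboundary E).

(** [C] acts freely by left multiplication, so each edge of a path in [H] from [x] to [y] has
    finitely many translates on which [E] changes. *)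
Lemma translate_separation x y : H x -> H y ->
  finite_set [set c | E (j c * x) <> E (j c * y)].
Proof.
move=> Hx Hy; elim: (conH Hx Hy) => [z _|z w t Hz zw wt IH].
  by apply: (sub_finite_set _ (finite_set0 C)) => c /=.
have fin := finite_preimage_inj (@morph_mulr_inj z) finE.
apply: (@sub_finite_set _ _ ([set c | relative_coboundary E (j c * z)] `|`
  [set c | E (j c * w) <> E (j c * t)])).
  move=> c /= nE; have [Ew|nEw] := pselect (E (j c * z) = E (j c * w)).
    by right; rewrite -Ew.
  left; split; first exact: jH.
  exists (j c * w); split=> //; last exact: adjacent_mull.
  by apply: jH; exact: path_in_src wt.
by rewrite finite_setU.
Qed.

(** Right translation of the trace by [c] amounts to replacing the base point [f] by [j c * f],
    which is again in [H]. *)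
Lemma translate_almost_invariant f : H f -> almost_invariant [set c | E (j c * f)].
Proof.
move=> Hf c; have := translate_separation Hf (jH c Hf).
by apply: sub_finite_set => d /=; rewrite jM mulgA.
Qed.

End Cut.

(* No edge leaves [E1 `&` E2] within [H], which is connected. *)
Lemma disjoint_cuts (E1 E2 : set G) k :
  (forall x y, H x -> H y -> adj x y -> E1 x <> E1 y -> ~ E2 x) ->
  (forall x y, H x -> H y -> adj x y -> E2 x <> E2 y -> ~ E1 x) ->
  H k -> ~ E2 k -> forall x, H x -> E1 x -> ~ E2 x.
Proof.
move=> cut1 cut2 Hk nk x Hx E1x E2x; apply: nk.
have [] // : (E1 `&` E2) k.
apply: path_in_closed (conH Hx Hk) _ => // z w [E1z E2z] Hz Hw zw; split.
  have [<-//|ne] := pselect (E1 z = E1 w); by have := cut1 _ _ Hz Hw zw ne.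
have [<-//|ne] := pselect (E2 z = E2 w); by have := cut2 _ _ Hz Hw zw ne.
Qed.

(** * Nested translates of a cut *)

Section Contradiction.
Variables (E : set G) (f0 : G).
Hypotheses (EH : E `<=` H) (Hf0 : H f0).
Hypothesis finE : finite_set (relative_coboundary E).

Let P : set C := [set c | E (j c * f0)].

(** The traces of [E] on any two orbits in [H] differ by finite sets, so one finite trace makes all
    of them finite. *)
Lemma finite_trace_finite :
  finite_set P -> finite_set E.
Proof.
move=> finP; apply: relative_thin_finite => // f.
have [Hf|nHf] := pselect (H f); last first.
  apply: (sub_finite_set _ (finite_set0 C)) => c /= /EH /(jH c^-1).
  by rewrite morph_V mulKg.
apply: (@sub_finite_set _ _ (P `|` [set c | E (j c * f) <> E (j c * f0)])).
  move=> c /= Ec; have [p|np] := pselect (P c); [by left|right] => eqE.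
  by apply: np; rewrite /P /= -eqE.
by rewrite finite_setU; split => //; exact: translate_separation.
Qed.

(* For all but finitely many [c], [E] is constant on [j c K] and on
   [(j c)^-1 K], where [K] is the coboundary of [E]; then [E] and its translate
   by [(j c)^-1] are nested. *)
Lemma nested_translate : infinite_set P -> infinite_set (~` P) ->
  exists z, [/\ forall x, H x -> E x -> E (j z * x),
    finite_set [set c | P c <> P (z * c)] &
    exists x, [/\ H x, E (j z * x) & ~ E x]].
Proof.
move=> infP infCP; have aiP := translate_almost_invariant finE Hf0.
have infgood := two_ended_translates twoC aiP infP infCP.
(* Both [P] and its complement are infinite, so each contains a point at which [c] does not change
   [P]. *)
have good_ex (b : Prop) c : finite_set [set x | P x <> P (c * x)] ->
    exists x, [/\ H x, E x = b & E (j c * x) = b].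
  move=> fc; have [p|np] := pselect b.
    have [d [Pd nd]] : P `\` [set x | P x <> P (c * x)] !=set0.
      by apply: infinite_setN0; exact: infinite_setD.
    move: nd => /= /contrapT nd.
    exists (j d * f0); split; [exact: jH| |]; apply/propext; split => //.
    by rewrite mulgA -jM; move: nd Pd; rewrite /P /= => ->.
  have [d [Pd nd]] : (~` P) `\` [set x | P x <> P (c * x)] !=set0.
    by apply: infinite_setN0; exact: infinite_setD.
  move: nd => /= /contrapT nd.
  exists (j d * f0); split; [exact: jH| |]; apply/propext; split => // q.
  by case: Pd; rewrite nd /P /= jM -mulgA.
pose K := relative_coboundary E.
(* Otherwise [E] would be constant on the connected set [H], and [P] or its complement would be
   empty. *)
have [k0 Kk0] : K !=set0.
  have [c Pc] : P !=set0 by exact: infinite_setN0.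
  have [d nPd] : ~` P !=set0 by exact: infinite_setN0.
  apply: contrapT => noK; apply: nPd; rewrite /P /=.
  apply: path_in_closed (conH (jH c Hf0) (jH d Hf0)) Pc => z w Ez Hz Hw zw.
  have [<-//|ne] := pselect (E z = E w).
  by case: noK; exists z; split => //; exists w.
have Hk0 : H k0 by case: Kk0.
pose bad := \bigcup_(k in K) [set c | E (j c * k) <> E (j c * k0)].
have finbad : finite_set bad.
  by apply: bigcup_finite => // k [Hk _]; exact: translate_separation.
pose bad' := [set c | bad c^-1].
have finbad' : finite_set bad' by apply: finite_preimage_inj finbad; exact: invg_inj.
(* Excluding these [c] ensures that [E] differs from its translate: [j c * k0] must leave the
   coboundary [K]. *)
pose bad'' := [set c | K (j c * k0)].
have finbad'' : finite_set bad''.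
  by apply: finite_preimage_inj finE; exact: morph_mulr_inj.
have [c [fc /not_orP[/not_orP[nbad nbad'] nbad'']]] :
    [set c | finite_set [set x | P x <> P (c * x)]] `\` (bad `|` bad' `|` bad'') !=set0.
  apply: infinite_setN0; apply: infinite_setD => //.
  by rewrite !finite_setU; split; [split|].
have constc k : K k -> E (j c * k) = E (j c * k0).
  by move=> Kk; apply: contrapT => ne; apply: nbad; exists k.
have constVc k : K k -> E (j c^-1 * k) = E (j c^-1 * k0).
  by move=> Kk; apply: contrapT => ne; apply: nbad'; exists k.
(* Where the first set changes, the point lies in [K], on which the translate of [E] by [c] is
   constant, so the point is outside the second set; the symmetric claim uses the inverse of [c]. *)
have nested x : H x -> E x <> E (j c^-1 * k0) -> ~ E (j c * x) <> E (j c * k0).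
  apply: (@disjoint_cuts [set x | E x <> E (j c^-1 * k0)]
    [set x | E (j c * x) <> E (j c * k0)] k0) => //=.
    move=> y w Hy Hw yw ne; apply; apply: constc; split => //.
    by exists w; split => //; apply: contra_not ne => ->.
  move=> y w Hy Hw yw ne; apply; rewrite -[y in LHS](mulKg (j c)) -morph_V.
  apply: constVc; split; first exact: jH.
  exists (j c * w); split; [exact: jH|exact: adjacent_mull|].
  by apply: contra_not ne => ->.
have [y [Hy yE]] : exists y, H y /\ E (j c * y) <> E y.
  apply: contrapT => noy; have eqE y : H y -> E (j c * y) = E y.
    by move=> Hy; apply: contrapT => ne; apply: noy; exists y.
  apply: nbad''; case: Kk0 => _ [w [Hw kw ne]]; split; first exact: jH.
  exists (j c * w); split; [exact: jH|exact: adjacent_mull|].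
  by rewrite !eqE.
have fVc : finite_set [set x | P x <> P (c^-1 * x)].
  have := finite_preimage_inj (@mulgI _ c^-1) fc; apply: sub_finite_set => x /=.
  by rewrite mulVKg => /nesym.
(* The two constants decide which intersection of [E], its translate and their complements is empty.
   Equal constants are excluded by [good_ex]; unequal ones give [z] equal to [c] or to its
   inverse. *)
have [a|na] := pselect (E (j c * k0)); have [b|nb] := pselect (E (j c^-1 * k0)).
- have [x [Hx Ex Ecx]] := good_ex False c fc.
  by case: (nested x Hx); rewrite ?Ex ?Ecx => ->.
- have cE x : H x -> E x -> E (j c * x).
    move=> Hx Ex; apply: contrapT => nEx; apply: (nested x Hx).
      by move=> e; apply: nb; rewrite -e.
    by move=> e; apply: nEx; rewrite e.
  exists c; split => //; exists y; split => //.
    by apply: contrapT => nEy; apply: yE; apply/propext; split => // /(cE _ Hy).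
  by move=> Ey; apply: yE; apply/propext; split => // _; exact: cE.
- have cE x : H x -> E (j c * x) -> E x.
    move=> Hx Ex; apply: contrapT => nEx; apply: (nested x Hx).
      by move=> e; apply: nEx; rewrite e.
    by move=> e; apply: na; rewrite -e.
  have Vc x : j c^-1 * (j c * x) = x by rewrite morph_V mulKg.
  have cV x : j c * (j c^-1 * x) = x by rewrite morph_V mulVKg.
  exists c^-1; split => //.
    by move=> x Hx Ex; apply: cE; [exact: jH|rewrite cV].
  exists (j c * y); rewrite Vc; split; first exact: jH.
    apply: contrapT => nEy; apply: yE; apply/propext; split => // /(cE _ Hy) //.
  move=> Ecy; apply: yE; apply/propext; split => // _; exact: cE.
- have [x [Hx Ex Ecx]] := good_ex True c fc.
  case: (nested x Hx); rewrite ?Ex ?Ecx => e; [apply: nb|apply: na];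
    by rewrite -e.
Qed.

(** Once in [E], a point stays there under further powers of [z]. Every point of [H] has a translate
    by a negative power outside [E] and is brought into [E] by positive powers; the last translate
    before entering [E] lies in the difference set. *)
Lemma nested_translate_covers z : infinite_set P -> infinite_set (~` P) ->
  (forall x, H x -> E x -> E (j z * x)) ->
  (exists x, [/\ H x, E (j z * x) & ~ E x]) ->
  H `<=` orbits [set x | [/\ H x, E (j z * x) & ~ E x]].
Proof.
move=> infP infCP zE [x1 [Hx1 Ezx1 nEx1]].
have jX n x : j (z ^+ n.+1) * x = j z * (j (z ^+ n) * x).
  by rewrite expgS jM mulgA.
have EX n x : H x -> E x -> E (j (z ^+ n) * x).
  move=> Hx Ex; elim: n => [|n IH]; first by rewrite expg0 morph_1 mul1g.
  by rewrite jX; apply: zE => //; exact: jH.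
(* [j z * x1] and its later translates are in [E]; if a positive power of [z] were trivial, they
   would include [x1]. *)
have zX_neq1 n : z ^+ n.+1 <> 1.
  move=> zn1; apply: nEx1; rewrite -[x1]mul1g -morph_1 -zn1 expgSr jM -mulgA.
  by apply: EX => //; exact: jH.
have zX_inj : injective (fun n => z ^+ n).
  suff lt m n : (m < n)%N -> z ^+ m <> z ^+ n.
    move=> m n mn; have [/lt|/lt|//] := ltngtP m n; first by [].
    by move/nesym.
  move=> mn; rewrite -(subnKC mn) addSnnS.
  by rewrite expgnDr -{1}[z ^+ m]mulg1 => /mulgI /esym /zX_neq1.
(* The traces through [x] and [y] differ at finitely many elements of [C], while [h] takes
   infinitely many values. *)
have separated (h : nat -> C) x y : injective h -> H x -> H y ->
    (forall n, E (j (h n) * y)) -> exists n, E (j (h n) * x).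
  move=> hI Hx Hy Ey; apply: contrapT => noE; apply: infinite_nat.
  have := finite_preimage_inj hI (translate_separation finE Hx Hy).
  apply: sub_finite_set => n _ /= eqE; apply: noE; exists n.
  by rewrite eqE.
move=> x Hx.
have [c0 Pc0] : P !=set0 by exact: infinite_setN0.
have [c1 nPc1] : ~` P !=set0 by exact: infinite_setN0.
(* Otherwise some negative power of [z] would move [j c1 * f0] into [E], and returning by the
   positive power would give [P c1]. *)
have [m nEm] : exists m, ~ E (j (z ^+ m)^-1 * x).
  apply: contrapT => noE; apply: nPc1.
  have [] := separated (fun n => (z ^+ n)^-1) (j c1 * f0) x => //.
  - by move=> m n /invg_inj /zX_inj.
  - exact: jH.
  - by move=> n; apply: contrapT => nE; apply: noE; exists n.
  move=> n En; have := EX n _ (jH _ (jH c1 Hf0)) En.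
  by rewrite mulgA -jM mulgV morph_1 mul1g.
set w := _ * x in nEm; have Hw : H w by exact: jH.
have [n En] : exists n, E (j (z ^+ n) * w).
  have := separated (fun n => z ^+ n) w (j c0 * f0); apply => //; first exact: jH.
  by move=> n; apply: EX => //; exact: jH.
have [k [Ek nEk]] : exists k, E (j (z ^+ k.+1) * w) /\ ~ E (j (z ^+ k) * w).
  elim: n En => [|n IH] En; first by case: nEm; move: En; rewrite expg0 morph_1 mul1g.
  by have [/IH|nE] := pselect (E (j (z ^+ n) * w)); last by exists n.
exists (z ^+ m * (z ^+ k)^-1), (j (z ^+ k) * w); split.
  by split; [exact: jH|rewrite -jX|].
by rewrite mulgA -jM mulgVK /w mulgA -jM mulgV morph_1 mul1g.
Qed.

End Contradiction.

(** A finite trace of [E], or of its complement in [H], settles the claim. Otherwise the difference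
    [D] of [E] and a nested translate is finite on every orbit, hence finite, although its orbits
    cover [H]. *)
Theorem relative_cut_finite E : E `<=` H -> finite_set (relative_coboundary E) ->
  finite_set E \/ finite_set (H `\` E).
Proof.
move=> EH finE.
have [f0 Hf0] : H !=set0.
  apply: contrapT => noH; apply: (bigH (finite_set0 G)) => x Hx.
  by case: noH; exists x.
pose P := [set c | E (j c * f0)].
have [finP|infP] := pselect (finite_set P).
  by left; exact: finite_trace_finite finP.
have [finCP|infCP] := pselect (finite_set (~` P)).
  (* The complement of [E] in [H] has its relative coboundary inside that of [E], and its trace
     inside the complement of [P]. *)
  right; apply: (@finite_trace_finite _ f0) => //.
    apply: sub_finite_set finE => x [Hx [y [Hy xy ne]]]; split => //.
    exists y; split => //; apply: contra_not ne => e; apply/propext.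
    by rewrite /setD /mkset e; split=> -[].
  by apply: sub_finite_set finCP => c /= [].
have [z [zE finz exz]] := nested_translate Hf0 finE infP infCP.
have cover := nested_translate_covers Hf0 finE infP infCP zE exz.
case: (bigH _ cover); set D := [set x | _].
have finE' := finite_preimage_inj (@mulgI _ (j z)) finE.
have DE x y : D x <> D y -> H x -> H y -> E (j z * x) = E (j z * y) -> E x <> E y.
  move=> ne Hx Hy e1 e2; apply: ne; rewrite /D /=; apply/propext.
  by rewrite e1 e2; split=> -[].
apply: relative_thin_finite => [x []//||f].
  apply: (@sub_finite_set _ _ ([set x | relative_coboundary E (j z * x)] `|`
    relative_coboundary E)).
    move=> x [Hx [y [Hy xy ne]]].
    have [e|ne'] := pselect (E (j z * x) = E (j z * y)); [right|left].
      by split => //; exists y; split => //; exact: DE.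
    split; first exact: jH; exists (j z * y).
    by split => //; [exact: jH|exact: adjacent_mull].
  by rewrite finite_setU.
have [Hf|nHf] := pselect (H f); last first.
  apply: (sub_finite_set _ (finite_set0 C)) => c /= [/(jH c^-1)].
  by rewrite morph_V mulKg.
have fT := translate_separation finE Hf Hf0.
(* Where the traces at [f] and [f0] agree for both [c] and [z * c], membership of [j c * f] in [D]
   means that [P] changes from [c] to [z * c]. *)
apply: (@sub_finite_set _ _ ([set c | E (j c * f) <> E (j c * f0)] `|`
  [set c | E (j (z * c) * f) <> E (j (z * c) * f0)] `|`
  [set c | P c <> P (z * c)])).
  move=> c [_ Ez nE]; apply: contrapT => /not_orP[/not_orP[/contrapT n1 /contrapT n2] /contrapT n3].
  by apply: nE; rewrite n1; move: n3; rewrite /P /= => ->; rewrite -n2 jM -mulgA.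
rewrite !finite_setU; split => //; split => //.
exact: finite_preimage_inj (@mulgI _ z) fT.
Qed.

(** An infinite component [E] left by a finite [K] has its relative coboundary among [K] and its
    neighbours. So the rest of [H] is finite and contains no second infinite component. *)
Theorem one_ended_induced : one_ended (@induced (cayley S) H).
Proof.
have lfS := locally_finite_cayley finS.
pose Y := @induced (cayley S) H.
have lfY : locally_finite Y by exact: locally_finite_induced.
have conY : connected_graph Y by exact/connected_inducedP.
have infY : infinite_set [set: vertex Y].
  move=> /(finite_image sval) finH; apply: (bigH finH) => x Hx.
  exists 1, x; split; last by rewrite morph_1 mul1g.
  by exists (exist _ x Hx).
split=> // K finK.
have [|U [unbU _ _]] := infinite_closed_component conY lfY finK infY; first by [].
exists U; split=> // V unbV.
have [x [nKx infx ->]] := unbounded_component_infinite conY lfY unbU.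
have [y [nKy infy ->]] := unbounded_component_infinite conY lfY unbV.
suff xy : path_in (~` K) x y.
  apply/seteqP; split=> b /=; last exact: path_in_trans.
  by apply: path_in_trans; exact: path_in_sym.
have svalI : injective (fun a : vertex Y => sval a).
  by move=> [a Ha] [b Hb] /= ab; exact: eq_exist.
pose E := [set sval a | a in path_in (~` K) x].
have EH : E `<=` H by move=> _ [a _ <-]; exact: svalP.
have inE a : E (sval a) <-> path_in (~` K) x a.
  by split=> [[b xb /svalI <-]|xa] //; exists a.
have finE : finite_set (relative_coboundary E).
  pose K' := [set sval k | k in K].
  have finK' : finite_set K' by exact: finite_image.
  apply: (@sub_finite_set _ _ (K' `|`
    \bigcup_(k in K') [set z | @adjacent (cayley S) k z])).
    move=> g [Hg [h [Hh gh ne]]]; pose a : vertex Y := exist _ g Hg.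
    pose b : vertex Y := exist _ h Hh.
    have ab : adjacent a b by apply/adjacent_inducedP.
    have [Ka|nKa] := pselect (K a); first by left; exists a.
    have [Kb|nKb] := pselect (K b).
      by right; exists h; [exists b|exact: adjacentC].
    case: ne; rewrite -[g]/(sval a) -[h]/(sval b); apply/propext.
    split=> /inE xa; apply/inE; apply: path_in_trans xa _; apply: path_in_step => //.
    exact: adjacentC.
  rewrite finite_setU; split => //; apply: bigcup_finite => // k _.
  exact: finite_adjacent.
have finP A : finite_set [set sval a | a in A] -> finite_set (A : set (vertex Y)).
  move=> finA; apply: sub_finite_set (finite_preimage_inj svalI finA) => a Aa.
  by exists a.
have [/finP //|finHE] := relative_cut_finite EH finE.
apply: contrapT => nxy; apply: infy; apply: finP; apply: sub_finite_set finHE.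
move=> _ [a ya <-]; split; first exact: svalP.
by move=> /inE xa; apply: nxy; apply: path_in_trans xa (path_in_sym ya).
Qed.

End RelativeEnds.

(** * Halfspaces of trees *)

Section Tree.
Variables (G : groupType) (T : graph_action G).
Implicit Types (c d : vertex T -> bool) (e f : edge T) (x y : vertex T) (g k : G).

(** A two-colouring of the vertices that changes exactly across [e]; it expresses that [e]
    disconnects the graph, and the tree property is used in this form. *)
Definition separates c e := forall f, c (src f) <> c (tgt f) <-> f = e.

Definition is_end e x := x = src e \/ x = tgt e.

Lemma vactK g : cancel (@vact G T g) (vact g^-1).
Proof. by move=> x; rewrite -vactM mulVg vact1. Qed.

Lemma vactKV g : cancel (@vact G T g^-1) (vact g).
Proof. by move=> x; rewrite -vactM mulgV vact1. Qed.

Lemma eactK g : cancel (@eact G T g) (eact g^-1).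
Proof. by move=> x; rewrite -eactM mulVg eact1. Qed.

Lemma separates_vact c e g :
  separates c (eact g e) -> separates (fun x => c (vact g x)) e.
Proof.
move=> ce f; rewrite -src_eact -tgt_eact; split=> [/ce|->]; last exact/ce.
exact: (can_inj (eactK g)).
Qed.

Lemma separates_ends c e : separates c e -> c (src e) <> c (tgt e).
Proof. by move=> /(_ e) [_]; apply. Qed.

Lemma separates_neq c e f : separates c e -> f <> e -> c (src f) = c (tgt f).
Proof. by move=> ce fe; apply: contrapT => /ce. Qed.

Hypothesis conT : connected_graph T.

Lemma constant_on_edges (U : Type) (c : vertex T -> U) :
  (forall e, c (src e) = c (tgt e)) -> forall x y, c x = c y.
Proof.
move=> cE x y; have /joinedP := conT x y.
by elim=> // {}x z {}y _ [e [] [<- <-]] _ <-; rewrite cE.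
Qed.

(** Without crossing [e] every vertex can be joined to an end of [e], and the two ends have
    different colours. *)
Lemma halfspace_side c e h : separates c e -> halfspace e h ->
  exists b, h = [set y | c y = b].
Proof.
move=> ce [x ->]; exists (c x).
have adjE y z f : f <> e -> src f = y /\ tgt f = z \/ src f = z /\ tgt f = y ->
    @adjacent (delete_edge e) y z.
  by move=> fe; exists (exist _ f fe).
have const y z : @joined (delete_edge e) y z -> c y = c z.
  move=> /joinedP; elim=> // {}y w {}z _ [[f fe]] /= yw _ <-.
  by have := separates_neq ce fe; case: yw => -[-> ->].
pose near y := exists2 p, is_end e p & @path_in (delete_edge e) setT y p.
have nearT y : near y.
  have /joinedP ey := conT (src e) y; apply: (path_in_closed _ ey); last first.
    by exists (src e); [left|exact: path_in_nil].
  move=> z w [p pe zp] _ _ [f fzw].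
  have [fe|fe] := pselect (f = e).
    exists w; last exact: path_in_nil.
    by rewrite -fe /is_end; case: fzw => -[? ?]; [right|left].
  exists p => //; apply: path_in_cons zp => //.
  by apply: adjE fe _; case: fzw; [right|left].
apply/seteqP; split=> y /=; first by move=> /const.
have [p pe xp] := nearT x; have [q qe yq] := nearT y.
have /const -> := (joinedP _ _).2 xp; have /const -> := (joinedP _ _).2 yq.
move=> cqp; apply/joinedP; apply: path_in_trans xp _.
suff -> : p = q by exact: path_in_sym.
have := separates_ends ce.
by case: pe qe cqp => -> [] -> // ->.
Qed.

(** [c] and its translate by [g] both change exactly across [e], so their sum modulo 2 is constant.
    It vanishes at [src e], which [g] fixes since orientations are preserved. *)
Lemma separates_stabilizer c e g : separates c e -> eact g e = e ->
  forall x, c (vact g x) = c x.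
Proof.
move=> ce ge x.
have cge : separates (fun x => c (vact g x)) e by apply: separates_vact; rewrite ge.
apply/eqP; rewrite -negb_add; apply/negP.
rewrite (@constant_on_edges _ (fun x => c (vact g x) (+) c x) _ x (src e)).
  by rewrite -src_eact ge addbb.
move=> f; have [->|fe] := pselect (f = e); last first.
  by rewrite (separates_neq ce fe) (separates_neq cge fe).
have := separates_ends ce; have := separates_ends cge.
by case: (c _) (c _) (c _) (c _) => [] [] [] [].
Qed.

(* The side [d = b] of [f] misses the edge [e], so it lies on one side of [e]. *)
Lemma separates_nested c d e f b : separates c e -> separates d f -> e <> f ->
  d (src e) <> b -> forall y, d y = b -> c y = c (src f).
Proof.
move=> ce df ef deb y dy.
(* [s] keeps [c] on the side [d = b] and is constant elsewhere; it changes neither across [f], where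
   [c] is constant, nor across [e], which is off that side. *)
pose s z := if d z == b then c z else c (src f).
have := @constant_on_edges _ s _ y (src e).
have /eqP/negbTE sF := deb; rewrite /s dy eqxx sF; apply => k.
have [->|kf] := pselect (k = f).
  by rewrite -(separates_neq ce (nesym ef)); do 2 case: ifP => _.
rewrite (separates_neq df kf); case: ifP => // dk.
apply: (separates_neq ce) => ke; apply: deb.
by rewrite -ke (separates_neq df kf); exact/eqP.
Qed.

(** [k] maps the side [c = b] to a side of [eact k e] that misses [r], hence misses [e]. So [c] is
    constant on the image, with its value at the end [vact k s] of [eact k e]. *)
Lemma separates_push c e k r s b : separates c e -> eact k e <> e ->
  is_end e r -> is_end e s -> c (vact k^-1 r) <> b ->
  forall y, c y = b -> c (vact k y) = c (vact k s).
Proof.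
move=> ce ke re se crb y cy.
have df : separates (fun x => c (vact k^-1 x)) (eact k e).
  by apply: separates_vact; rewrite eactK.
have -> : c (vact k s) = c (src (eact k e)).
  by case: se => ->; rewrite -?tgt_eact -?src_eact // (separates_neq ce ke).
apply: (separates_nested ce df (nesym ke) _ (b := b)); last by rewrite vactK.
by case: re crb => -> //; rewrite (separates_neq df (nesym ke)).
Qed.

(* The first case occurs for amalgams, the second for HNN extensions. *)
Definition movable e : Prop :=
  (exists a b, [/\ vact a (src e) = src e, eact a e <> e,
     vact b (tgt e) = tgt e & eact b e <> e]) \/
  ((exists k, vact k (src e) = tgt e) /\ forall x, exists g, vact g x = src e).

Definition shrinks c (b : bool) k : Prop :=
  (forall y, c y = b -> c (vact k y) = b) /\
  exists2 y, c y = b & c (vact k^-1 y) <> b.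

Lemma vactV_fix g x : @vact G T g x = x -> vact g^-1 x = x.
Proof. by move=> {1}<-; rewrite vactK. Qed.

(** Ping-pong: [b] fixes [q] and moves [e], so it sends the side of [p] into that of [q]; likewise
    [a] sends the side of [q] into that of [p]. *)
Lemma elliptic_shrinks c e p q a b : separates c e ->
  is_end e p -> is_end e q -> c p <> c q ->
  vact a p = p -> eact a e <> e -> vact b q = q -> eact b e <> e ->
  shrinks c (c p) (a * b) /\ forall x, exists g, c (vact g x) = c p.
Proof.
move=> ce pe qe cpq ap ae bq be.
have pushb y : c y = c p -> c (vact b y) = c q.
  move=> cy; rewrite (separates_push ce be qe qe _ cy) ?bq //.
  by rewrite vactV_fix //; exact: nesym.
have pusha y : c y <> c p -> c (vact a y) = c p.
  move=> cy; rewrite (separates_push ce ae pe pe _ (erefl (c y))) ?ap //.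
  by rewrite vactV_fix //; exact: nesym.
split; last first.
  move=> x; have [cx|cx] := pselect (c x = c p); first by exists 1; rewrite vact1.
  by exists a; exact: pusha.
split=> [y /pushb cy|].
  by rewrite vactM; apply: pusha; rewrite cy; exact: nesym.
exists p => //; rewrite invgM vactM (vactV_fix ap) => /pushb.
by rewrite vactKV.
Qed.

(** [k] moves [e], since an element fixing [e] preserves its sides. As the preimage [p] of [q] is on
    the other side, the side of [q] is pushed into itself and misses [q]. *)
Lemma hyperbolic_shrinks c e p q k : separates c e ->
  is_end e p -> is_end e q -> c p <> c q -> vact k p = q -> shrinks c (c q) k.
Proof.
move=> ce pe qe cpq kp.
have kVq : vact k^-1 q = p by rewrite -kp vactK.
have ke : eact k e <> e.
  move=> ke; apply: cpq; have := separates_ends ce; rewrite -[q]kp.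
  have := separates_stabilizer ce ke p.
  by move=> ->.
split=> [y cy|]; last by exists q; rewrite ?kVq.
by rewrite (separates_push ce ke qe pe _ cy) ?kp // kVq.
Qed.

Lemma movable_shrinks c e b : separates c e -> movable e ->
  (exists k, shrinks c b k) /\ forall x, exists g, c (vact g x) = b.
Proof.
move=> ce; have ne := separates_ends ce.
have [se te] : is_end e (src e) /\ is_end e (tgt e) by split; [left|right].
have bE : b = c (src e) \/ b = c (tgt e).
  by move: ne; case: b (c (src e)) (c (tgt e)) => [] [] [] ?; by [left|right].
move=> [[a [a' [aE aN a'E a'N]]]|[[k kE] trans]].
  case: bE => ->.
    have [sh all] := elliptic_shrinks ce se te ne aE aN a'E a'N.
    by split => //; exists (a * a').
  have [sh all] := elliptic_shrinks ce te se (nesym ne) a'E a'N aE aN.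
  by split => //; exists (a' * a).
case: bE => ->; split.
- exists k^-1; apply: (hyperbolic_shrinks ce te se (nesym ne)).
  by rewrite -kE vactK.
- by move=> x; have [g gx] := trans x; exists g; rewrite gx.
- by exists k; exact: (hyperbolic_shrinks ce se te ne).
- by move=> x; have [g gx] := trans x; exists (k * g); rewrite vactM gx kE.
Qed.

(** * Halfspaces and orbits of the edge stabilizer *)

Section Stabilizer.
Variables (C : groupType) (j : C -> G) (c : vertex T -> bool) (e : edge T).
Hypotheses (ce : separates c e) (jE : forall g, eact g e = e <-> exists a, g = j a).

(** Let [k] shrink the side containing [g v]. If finitely many orbits contained all [k ^+ n * g], a
    positive power of [k] would fix [e] and so preserve the side, which [k] maps properly into
    itself. *)
Lemma side_not_in_orbits v b F : movable e -> finite_set F ->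
  ~ ([set g | c (vact g v) = b] `<=` orbits j F).
Proof.
move=> me finF sideF; have [[k [kb [y0 y0b y0k]]] all] := movable_shrinks b ce me.
have [g gb] := all v.
have kX n y : c y = b -> c (vact (k ^+ n) y) = b.
  move=> cy; elim: n => [|n IH]; first by rewrite expg0 vact1.
  by rewrite expgS vactM; exact: kb.
have /choice [r fP] : forall n : nat,
    exists r : G, F r /\ exists a, k ^+ n * g = j a * r.
  move=> n; have [|a [r [Fr er]]] := sideF (k ^+ n * g).
    by rewrite /= vactM; exact: kX.
  by exists r; split => //; exists a.
have noninj m n : (m < n)%N -> r m <> r n.
  move=> mn fmn; have [_ [u eu]] := fP m; have [_ [w ew]] := fP n.
  rewrite -fmn -(subnK mn) addnS -addSn expgnDr -mulgA eu mulgA in ew.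
  move/mulIg: ew => ew; set d := (n - m.+1)%N in ew.
  have fixj a y : c (vact (j a) y) = c y.
    by apply: separates_stabilizer ce _ _; apply/jE; exists a.
  have kd y : c (vact (k ^+ d.+1) y) = c y.
    by rewrite -[y in LHS](vactKV (j u)) -vactM ew fixj -(fixj u) vactKV.
  (* The inverse of [k] is [k ^+ d] times the inverse of [k ^+ d.+1], and the latter preserves the
     side. *)
  apply: y0k; have := kX d (vact (k ^+ d.+1)^-1 y0).
  rewrite -kd vactKV -vactM expgS invgM mulgA mulgV mul1g; exact.
apply: infinite_nat; have finj : injective r.
  by move=> m n; have [/noninj|/noninj /nesym|//] := ltngtP m n.
by apply: sub_finite_set (finite_preimage_inj finj finF) => n _; case: (fP n).
Qed.

(** If [g] separates [x] from [y], it carries an edge of a fixed path between them to [e]; the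
    elements carrying a given edge to [e] form at most one right coset of the stabilizer. *)
Lemma frontier_in_orbits x y : exists2 F, finite_set F &
  [set g | c (vact g x) <> c (vact g y)] `<=` orbits j F.
Proof.
have /joinedP := conT x y; elim=> [z _|z w t _ [f fzw] _ [F finF FP]].
  by exists set0 => // g /=.
have fe g : c (vact g z) <> c (vact g w) -> eact g f = e.
  move=> ne; apply/ce; rewrite src_eact tgt_eact.
  by case: fzw => -[-> ->] //; exact: nesym.
have [[g0 g0f]|nof] := pselect (exists g, eact g f = e).
  exists (g0 |` F); first by rewrite finite_setU; split => //; exact: finite_set1.
  move=> g /= ne; have [zw|/fe gf] := pselect (c (vact g z) = c (vact g w)).
    by have [|a [h [Fh ->]]] := FP g; [rewrite /= -zw|exists a, h; split => //; right].
  have /jE [a ea] : eact (g * g0^-1) e = e by rewrite eactM -g0f eactK gf.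
  by exists a, g0; split; [left|rewrite -ea mulgVK].
exists F => // g ne; apply: FP => /=.
have [<-//|/fe gf] := pselect (c (vact g z) = c (vact g w)).
by case: nof; exists g.
Qed.

Theorem one_ended_halfspace (v : vertex T) (S : set G) (h : set (vertex T)) :
  {morph j : a b / a * b} -> injective j ->
  one_ended_group G -> two_ended_group C -> movable e ->
  admissible_generators v S -> halfspace e h -> one_ended (group_halfspace v S h).
Proof.
move=> jM jI oneG twoC me [finS genS conS] eh.
have /connected_inducedP conH := conS e h eh.
have [b hb] := halfspace_side ce eh.
apply: (@one_ended_induced G C j) => //.
- move=> a x; rewrite /= hb /= vactM => <-.
  by apply: separates_stabilizer ce _ _; apply/jE; exists a.
- move=> g; have [F finF FP] := frontier_in_orbits v (vact g v).
  exists F => // x ne; apply: FP => /=; apply: contra_not ne.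
  by rewrite hb /= vactM => ->.
- by move=> F finF; rewrite hb; exact: side_not_in_orbits.
(* The complement is the opposite side of [e], to which the same lemma applies. *)
- move=> F finF HF; apply: (side_not_in_orbits (b := ~~ b) (v := v) me finF).
  by move=> g /= gb; apply: HF; rewrite /= hb /= gb; case: (b).
Qed.

End Stabilizer.
End Tree.

(** * Splittings *)

Lemma multiplicativeP (G H : groupType) (f : G -> H) :
  {morph f : x y / x * y} -> exists phi : {multiplicative G -> H}, phi =1 f.
Proof.
move=> fM.
by exists (HB.pack_for {multiplicative G -> H} f (isMultiplicative.Build G H f fM)).
Qed.

(** * The group of bijections of a type *)

Record bijection (T : Type) := Bijection {
  bij_fun :> T -> T;
  bij_inv : T -> T;
  bij_funK : cancel bij_fun bij_inv;
  bij_invK : cancel bij_inv bij_fun }.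

Section BijectionGroup.
Variable T : Type.
Implicit Types f g h : bijection T.

Lemma bijection_ext f g : f =1 g -> f = g.
Proof.
case: f g => [f f' fK f'K] [g g' gK g'K] /= fg.
have {}fg : f = g by exact: funext.
have fg' : f' = g' by apply/funext => x; rewrite -{1}(g'K x) -fg fK.
by subst; congr Bijection; exact: Prop_irrelevance.
Qed.

Definition bijection_one := @Bijection T id id (frefl _) (frefl _).
Definition bijection_inv f := Bijection (@bij_invK _ f) (@bij_funK _ f).
Definition bijection_mul f g :=
  Bijection (can_comp (@bij_funK _ f) (@bij_funK _ g))
    (can_comp (@bij_invK _ g) (@bij_invK _ f)).

HB.instance Definition _ := gen_eqMixin (bijection T).
HB.instance Definition _ := gen_choiceMixin (bijection T).

Fact bijection_mulA : associative bijection_mul.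
Proof. by move=> f g h; exact: bijection_ext. Qed.
Fact bijection_mul1g : left_id bijection_one bijection_mul.
Proof. by move=> f; exact: bijection_ext. Qed.
Fact bijection_mulg1 : right_id bijection_one bijection_mul.
Proof. by move=> f; exact: bijection_ext. Qed.
Fact bijection_mulVg : left_inverse bijection_one bijection_inv bijection_mul.
Proof. by move=> f; apply: bijection_ext => x /=; rewrite bij_funK. Qed.
Fact bijection_mulgV : right_inverse bijection_one bijection_inv bijection_mul.
Proof. by move=> f; apply: bijection_ext => x /=; rewrite bij_invK. Qed.

HB.instance Definition _ := isGroup.Build (bijection T) bijection_mulA
  bijection_mul1g bijection_mulg1 bijection_mulVg bijection_mulgV.

End BijectionGroup.

(* The semidirect product of [G] with the functions [G -> bool]: its
   homomorphic sections over [G] are the derivations [G -> (G -> bool)]. *)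
Definition crossed (G : groupType) : Type := (G * (G -> bool))%type.

Section CrossedGroup.
Variable G : groupType.
Implicit Types u v w : crossed G.

HB.instance Definition _ := gen_eqMixin (crossed G).
HB.instance Definition _ := gen_choiceMixin (crossed G).

Definition crossed_one : crossed G := (1, fun=> false).
Definition crossed_inv u : crossed G := (u.1^-1, fun x => u.2 (u.1 * x)).
Definition crossed_mul u v : crossed G :=
  (u.1 * v.1, fun x => u.2 x (+) v.2 (u.1^-1 * x)).

Fact crossed_mulA : associative crossed_mul.
Proof.
move=> [g p] [h q] [k r]; rewrite /crossed_mul /= mulgA; congr pair.
by apply/funext => x; rewrite invgM mulgA addbA.
Qed.
Fact crossed_mul1g : left_id crossed_one crossed_mul.
Proof.
move=> [g p]; rewrite /crossed_mul /= mul1g; congr pair.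
by apply/funext => x; rewrite invg1 mul1g.
Qed.
Fact crossed_mulg1 : right_id crossed_one crossed_mul.
Proof.
move=> [g p]; rewrite /crossed_mul /= mulg1; congr pair.
by apply/funext => x; rewrite addbF.
Qed.
Fact crossed_mulVg : left_inverse crossed_one crossed_inv crossed_mul.
Proof.
move=> [g p]; rewrite /crossed_mul /= mulVg; congr pair.
by apply/funext => x; rewrite invgK addbb.
Qed.
Fact crossed_mulgV : right_inverse crossed_one crossed_inv crossed_mul.
Proof.
move=> [g p]; rewrite /crossed_mul /= mulgV; congr pair.
by apply/funext => x; rewrite mulVKg addbb.
Qed.

HB.instance Definition _ := isGroup.Build (crossed G) crossed_mulA
  crossed_mul1g crossed_mulg1 crossed_mulVg crossed_mulgV.

(** The cocycle identity for functions modulo 2 on [G], on which [A] acts by left translation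
    through [i]. *)
Definition derivation (A : groupType) (i : A -> G) (d : A -> G -> bool) :=
  forall a b x, d (a * b) x = d a x (+) d b ((i a)^-1 * x).

Lemma crossed_morph (A : groupType) (i : A -> G) (d : A -> G -> bool) :
  {morph i : a b / a * b} -> derivation i d ->
  exists phi : {multiplicative A -> crossed G}, forall a, phi a = (i a, d a).
Proof.
move=> iM dM; apply: multiplicativeP (fun a => (i a, d a) : crossed G) _.
move=> a b; rewrite iM; congr pair; apply/funext => x; exact: dM.
Qed.

Lemma crossed_fst (phi : {multiplicative G -> crossed G}) :
  exists psi : {multiplicative G -> G}, forall g, psi g = (phi g).1.
Proof.
by apply: (multiplicativeP (f := fun g => (phi g).1)) => g h; rewrite gmulfM.
Qed.

End CrossedGroup.

Definition bool_of_set (T : Type) (P : set T) (x : T) : bool := `[< P x >].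

(* [p a] is the [C]-coordinate of [a] for a choice of right coset representatives. *)
Lemma equivariant_coordinate (A C : groupType) (i : {multiplicative C -> A}) :
  injective i -> exists p : A -> C, forall c a, p (i c * a) = c * p a.
Proof.
move=> iI; have i1 := morph_1 (@gmulfM _ _ i).
(* The representative of the coset of [a]; the default 1 is never taken, as the set contains [a]. *)
pose q a := xget 1 [set x | exists c, a = i c * x].
have qP a : exists c, a = i c * q a.
  have : [set x | exists c, a = i c * x] (q a).
    by rewrite /q; case: xgetP => // /(_ a) []; exists 1; rewrite i1 mul1g.
  by [].
have qE c a : q (i c * a) = q a.
  rewrite /q; congr xget; apply/seteqP; split=> x [d /= e].
    by exists (c^-1 * d); rewrite gmulfM -mulgA -e mulgA -gmulfM mulVg i1 mul1g.
  by exists (c * d); rewrite e gmulfM mulgA.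
have /choice [p pP] := qP.
exists p => c a; apply: iI; apply: (@mulIg _ (q a)).
by rewrite -{1}(qE c) -pP gmulfM -mulgA -pP.
Qed.

(* Write [a1 = i1 c * r] and [a2 = i2 c' * r'] with coset representatives
   [r], [r']; the map sends [(a1, a2)] to [(i2 c * r', i1 c' * r)]. *)
Lemma swap_cosets (A1 A2 C : groupType)
    (i1 : {multiplicative C -> A1}) (i2 : {multiplicative C -> A2}) :
  injective i1 -> injective i2 ->
  exists (s : A1 * A2 -> A2 * A1) (t : A2 * A1 -> A1 * A2),
    [/\ cancel s t, cancel t s &
      forall c u, s (i1 c * u.1, u.2) = (i2 c * (s u).1, (s u).2)].
Proof.
move=> I1 I2; have [p1 p1E] := equivariant_coordinate I1.
have [p2 p2E] := equivariant_coordinate I2.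
have m1 := morph_1 (@gmulfM _ _ i1); have m2 := morph_1 (@gmulfM _ _ i2).
exists (fun u => (i2 (p1 u.1 * (p2 u.2)^-1) * u.2, i1 (p2 u.2 * (p1 u.1)^-1) * u.1)).
exists (fun u => (i1 (p2 u.1 * (p1 u.2)^-1) * u.2, i2 (p1 u.2 * (p2 u.1)^-1) * u.1)).
split.
- move=> [a b] /=; rewrite !p1E !p2E !mulgVK !mulgA -!gmulfM !mulgA !mulgVK !mulgV.
  by rewrite m1 m2 !mul1g.
- move=> [a b] /=; rewrite !p1E !p2E !mulgVK !mulgA -!gmulfM !mulgA !mulgVK !mulgV.
  by rewrite m1 m2 !mul1g.
- move=> c [a b] /=; rewrite p1E; congr pair.
    by rewrite mulgA -gmulfM mulgA.
  by rewrite mulgA -gmulfM invgM mulgA mulgVK.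
Qed.

(** * Embedding of the vertex groups *)

Definition mull_bijection (A : groupType) (T : Type) (a : A) : bijection (A * T).
Proof.
apply: (@Bijection _ (fun u => (a * u.1, u.2)) (fun u => (a^-1 * u.1, u.2))).
- by move=> [x y] /=; rewrite mulKg.
- by move=> [x y] /=; rewrite mulVKg.
Defined.

Lemma mull_bijectionM (A : groupType) (T : Type) :
  {morph @mull_bijection A T : a b / a * b}.
Proof. by move=> a b; apply: bijection_ext => u /=; rewrite mulgA. Qed.

Definition conj_bijection (T U : Type) (s : T -> U) (t : U -> T)
  (sK : cancel s t) (tK : cancel t s) (f : bijection U) : bijection T.
Proof.
apply: (@Bijection _ (t \o f \o s) (t \o bij_inv f \o s)) => x /=.
- by rewrite tK bij_funK sK.
- by rewrite tK bij_invK sK.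
Defined.

(** [G] acts on [A * B]: [A] multiplies the first factor, and [B] acts by multiplication transported
    through the swap, which is equivariant under [C]. The images of suitable points recover the
    elements of [A] and of [B]. *)
Lemma amalgam_inj (G C : groupType) (a : amalgam G C) :
  injective (am_inA a) /\ injective (am_inB a).
Proof.
have [s [t [sK tK sE]]] := swap_cosets (@am_CA_inj _ _ a) (@am_CB_inj _ _ a).
have [f fE] := multiplicativeP (@mull_bijectionM (am_A a) (am_B a)).
have [|g gE] := @multiplicativeP (am_B a) (bijection (am_A a * am_B a))
    (fun b => conj_bijection sK tK (mull_bijection (am_A a) b)).
  by move=> b b'; apply: bijection_ext => u /=; rewrite tK /= mulgA.
have [|phi [phiA phiB]] := am_exists (f := f) (g := g).
  move=> c; rewrite fE gE; apply: bijection_ext => u /=.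
  by rewrite -sE sK.
split=> x y xy.
  have : f x (1, 1) = f y (1, 1) by rewrite -!phiA xy.
  by rewrite !fE /= !mulg1 => -[].
have : g x (t (1, 1)) = g y (t (1, 1)) by rewrite -!phiB xy.
by rewrite !gE /= tK /= !mulg1 => /(can_inj tK) [].
Qed.

(** [G] acts on [A * A]: [A] multiplies the first factor and [hnn_t] acts as the swap, which
    intertwines [hnn_beta] with [hnn_alpha]. *)
Lemma hnn_inj (G C : groupType) (a : hnn G C) : injective (hnn_in a).
Proof.
have [s [t [sK tK sE]]] := swap_cosets (@hnn_beta_inj _ _ a) (@hnn_alpha_inj _ _ a).
have [f fE] := multiplicativeP (@mull_bijectionM (hnn_A a) (hnn_A a)).
have [|phi [phiA _]] := hnn_exists (f := f) (s := Bijection sK tK).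
  move=> c; apply: (canLR (mulgK _)); rewrite !fE; apply: bijection_ext => u /=.
  exact: sE.
move=> x y xy; have : f x (1, 1) = f y (1, 1) by rewrite -!phiA xy.
by rewrite !fE /= !mulg1 => -[].
Qed.

(** * Derivations and generation *)

Section Derivations.
Variable G : groupType.

Lemma principal_derivation (n : G -> bool) :
  derivation id (fun g x => n x (+) n (g^-1 * x)).
Proof. by move=> g h x /=; rewrite invgM mulgA addbA addbK. Qed.

Lemma zero_derivation (A : groupType) (i : A -> G) :
  derivation i (fun _ _ => false).
Proof. by []. Qed.

Lemma crossed_derivation (phi : {multiplicative G -> crossed G}) :
  (forall g, (phi g).1 = g) -> derivation id (fun g => (phi g).2).
Proof. by move=> phi1 g h x; rewrite gmulfM /= phi1. Qed.

(** The principal derivation of the indicator of [P] vanishes on [P], hence everywhere; its value at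
    [g], evaluated at the point [g], compares [P g] with [P 1]. *)
Lemma subgroup_full (P : set G) : is_subgroup P ->
  (forall d : G -> G -> bool, derivation id d ->
    (forall g x, P g -> d g x = false) -> forall g x, d g x = false) ->
  forall g, P g.
Proof.
move=> [P1 PM PV] full g.
have /full : derivation id (fun g x => bool_of_set P x (+) bool_of_set P (g^-1 * x)).
  exact: principal_derivation.
move=> /(_ _ g g); rewrite mulVg /bool_of_set (asboolT P1) addbT => H.
apply/asboolP/negbFE/H => {H}h x Ph; apply/negbTE; rewrite negb_add.
apply/eqP; apply: asbool_equiv_eq; split=> [Px|]; first exact/PM/Px/PV.
by move=> /(PM _ _ Ph); rewrite mulVKg.
Qed.

End Derivations.

Section AmalgamDerivations.
Variables (G C : groupType) (a : amalgam G C).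

(** A derivation vanishing on both vertex groups gives a homomorphism to [crossed G] that agrees
    there with the trivial section, so they are equal by uniqueness. *)
Lemma amalgam_generated (P : set G) : is_subgroup P ->
  (forall x, P (am_inA a x)) -> (forall x, P (am_inB a x)) -> forall g, P g.
Proof.
move=> subP PA PB; apply: subgroup_full => // d dM dP g x.
have idM : {morph @id G : x y / x * y} by [].
have [phi phiE] := crossed_morph idM dM.
have [psi psiE] := crossed_morph idM (@zero_derivation G G id).
have : phi g = psi g.
  apply: (am_unique (a := a)) => y; rewrite phiE psiE; congr pair;
  by apply/funext => z; apply: dP.
by rewrite phiE psiE => -[->].
Qed.

(** Zero on [A] and the principal derivation of [n] on [B] agree on [C] because [n] is invariant
    under [C]. The universal property glues them, and its uniqueness makes the first coordinate the
    identity. *)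
Lemma amalgam_derivation (n : G -> bool) :
  (forall c x, n ((am_inA a (am_CA a c))^-1 * x) = n x) ->
  exists d : G -> G -> bool, [/\ derivation id d,
    forall y x, d (am_inA a y) x = false &
    forall y x, d (am_inB a y) x = n x (+) n ((am_inB a y)^-1 * x)].
Proof.
move=> nC; have [f fE] := crossed_morph (@gmulfM _ _ (am_inA a))
  (zero_derivation (am_inA a)).
have [|g gE] := crossed_morph (d := fun y x => n x (+) n ((am_inB a y)^-1 * x))
    (@gmulfM _ _ (am_inB a)).
  by move=> y z x /=; rewrite gmulfM invgM mulgA addbA addbK.
have [|phi [phiA phiB]] := am_exists (a := a) (f := f) (g := g).
  move=> c; rewrite fE gE am_comm; congr pair; apply/funext => x.
  by rewrite -am_comm nC addbb.
have [psi psiE] := crossed_fst phi.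
have phi1 h : (phi h).1 = h.
  rewrite -psiE; apply: (am_unique (a := a) (psi := idfun)) => y /=.
    by rewrite psiE phiA fE.
  by rewrite psiE phiB gE.
exists (fun h => (phi h).2); split; first exact: crossed_derivation.
- by move=> y x; rewrite phiA fE.
- by move=> y x; rewrite phiB gE.
Qed.

End AmalgamDerivations.

Section HnnDerivations.
Variables (G C : groupType) (a : hnn G C).

Lemma hnn_generated (P : set G) : is_subgroup P ->
  (forall x, P (hnn_in a x)) -> P (hnn_t a) -> forall g, P g.
Proof.
move=> subP PA Pt; apply: subgroup_full => // d dM dP g x.
have idM : {morph @id G : x y / x * y} by [].
have [phi phiE] := crossed_morph idM dM.
have [psi psiE] := crossed_morph idM (@zero_derivation G G id).
have : phi g = psi g.
  apply: (hnn_unique (h := a)) => [y|]; rewrite phiE psiE; congr pair;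
  by apply/funext => z; apply: dP.
by rewrite phiE psiE => -[->].
Qed.

(** With zero on [A] and value [n] at [hnn_t], the defining relation of the extension is exactly the
    invariance of [n] under [C]. *)
Lemma hnn_derivation (n : G -> bool) :
  (forall c x, n ((hnn_in a (hnn_alpha a c))^-1 * x) = n x) ->
  exists d : G -> G -> bool, [/\ derivation id d,
    forall y x, d (hnn_in a y) x = false & forall x, d (hnn_t a) x = n x].
Proof.
move=> nC; have [f fE] := crossed_morph (@gmulfM _ _ (hnn_in a))
  (zero_derivation (hnn_in a)).
have [|phi [phiA phit]] := hnn_exists (h := a) (f := f)
    (s := (hnn_t a, n) : crossed G).
  move=> c; apply: (canLR (mulgK _)); rewrite !fE.
  congr pair => /=; first by rewrite -hnn_comm mulgVK.
  by apply/funext => x; rewrite /= addbF nC.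
have [psi psiE] := crossed_fst phi.
have phi1 h : (phi h).1 = h.
  rewrite -psiE; apply: (hnn_unique (h := a) (psi := idfun)) => [y|] /=.
    by rewrite psiE phiA fE.
  by rewrite psiE phit.
exists (fun h => (phi h).2); split; first exact: crossed_derivation.
- by move=> y x; rewrite phiA fE.
- by move=> x; rewrite phit.
Qed.

End HnnDerivations.

(** * Cosets, representatives and stabilizers *)

Section CosetRepresentatives.
Variable G : groupType.
Implicit Types (H K : set G) (g h : G).

Lemma subgroup_range (A : groupType) (f : A -> G) :
  {morph f : x y / x * y} -> is_subgroup (range f).
Proof.
move=> fM; split; first by exists 1 => //; exact: morph_1.
- by move=> _ _ [x _ <-] [y _ <-]; exists (x * y).
- by move=> _ [x _ <-]; exists x^-1 => //; exact: morph_V.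
Qed.

Lemma translate_eqP H g h : is_subgroup H ->
  translate g H = translate h H <-> H (g^-1 * h).
Proof.
move=> [H1 HM HV]; split=> [gh|Hgh].
  have [x Hx <-] : translate g H h by rewrite gh; exists 1; rewrite ?mulg1.
  by rewrite mulKg.
apply/seteqP; split=> _ [x Hx <-].
  exists ((g^-1 * h)^-1 * x); first by apply: HM => //; exact: HV.
  by rewrite invgM invgK !mulgA mulgV mul1g.
by exists (g^-1 * h * x); [exact: HM|rewrite !mulgA mulgV mul1g].
Qed.

Definition coset_rep H (P : coset H) : G := sval (cid (svalP P)).

Lemma coset_repE H (P : coset H) : sval P = translate (coset_rep P) H.
Proof. exact: svalP (cid (svalP P)). Qed.

Lemma coset_act_eqP H g (P : coset H) : is_subgroup H ->
  coset_act g P = P <-> H ((coset_rep P)^-1 * g * coset_rep P).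
Proof.
move=> subH; have subH' := subH; case: subH' => _ _ HV.
have -> : coset_act g P = P <-> sval (coset_act g P) = sval P.
  by split=> [->//|]; exact: coset_inj.
rewrite /= coset_repE -translateM (translate_eqP _ _ subH) invgM.
split=> /HV; rewrite !invgM !invgK ?mulgA //.
Qed.

Lemma coset_rep_const (U : Type) H (F : G -> U) (P : coset H) g : is_subgroup H ->
  (forall x h, H h -> F (x * h) = F x) -> sval P = translate g H ->
  F (coset_rep P) = F g.
Proof.
move=> subH FH; rewrite coset_repE => /(translate_eqP _ _ subH) Hg.
by rewrite -(FH _ _ Hg) mulVKg.
Qed.

Lemma coset_mapE H K t (HtK : mulset H (translate t K) = translate t K)
    (P : coset H) :
  sval (coset_map HtK P) = translate (coset_rep P * t) K.
Proof. by rewrite /= coset_repE mulset_translate HtK translateM. Qed.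

End CosetRepresentatives.

(** Connectedness of the orbit of [x0] then needs checking on generators only. *)
Lemma subgroup_joined (G : groupType) (T : graph_action G) (x0 : vertex T) :
  is_subgroup [set g | joined x0 (vact g x0)].
Proof.
have act g x y : joined x y -> joined (vact g x) (@vact G T g y).
  move=> /joinedP xy; apply/joinedP; elim: xy => [z _|z w t _ [f fzw] _ IH].
    exact: path_in_nil.
  apply: path_in_cons IH => //; exists (eact g f); rewrite src_eact tgt_eact.
  by case: fzw => -[-> ->]; [left|right].
have trans x y z : joined x y -> joined y z -> @joined T x z.
  by move=> /joinedP xy /joinedP yz; apply/joinedP; exact: path_in_trans yz.
have sym x y : joined x y -> @joined T y x.
  by move=> /joinedP xy; apply/joinedP; exact: path_in_sym.
split=> /= [|g h jg jh|g jg].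
- by rewrite vact1; exists 0; exact: walk_nil.
- by rewrite vactM; apply: trans jg _; exact: act.
- by apply: sym; have := act g^-1 _ _ jg; rewrite vactK.
Qed.

Section CosetBase.
Variables (G : groupType) (H : set G).
Hypothesis subH : is_subgroup H.

Definition coset_base : coset H := exist _ (translate 1 H) (ex_intro _ 1 erefl).

Lemma coset_act_base g (P : coset H) :
  sval P = translate g H -> P = coset_act g coset_base.
Proof. by move=> PE; apply: coset_inj; rewrite PE /= translate1. Qed.

Lemma coset_act_rep (P : coset H) : coset_act (coset_rep P) coset_base = P.
Proof. by apply/esym/coset_act_base; exact: coset_repE. Qed.

Lemma coset_base_fix g : H g -> coset_act g coset_base = coset_base.
Proof.
move=> Hg; apply: coset_inj; rewrite /= -translateM mulg1.
by apply/(translate_eqP _ _ subH); case: subH => _ _ HV; rewrite mulg1; exact: HV.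
Qed.

Lemma coset_stabilizer (C : Type) (j : C -> G) (P : coset H) g : H = range j ->
  coset_act g P = P <->
  exists c, g = coset_rep P * j c * (coset_rep P)^-1.
Proof.
move=> Hj; have HE x : H x <-> range j x by rewrite Hj.
rewrite coset_act_eqP // HE; split=> [[c _ jc]|[c ->]].
  by exists c; rewrite jc !mulgA mulgV mul1g mulgK.
by exists c => //; rewrite !mulgA mulVg mul1g mulgVK.
Qed.

Lemma coset_conj_moves g (P : coset H) : ~ H g ->
  coset_act (coset_rep P * g * (coset_rep P)^-1) P <> P.
Proof.
by move=> nHg; rewrite coset_act_eqP // !mulgA mulVg mul1g mulgVK.
Qed.

End CosetBase.

Lemma conj_morph (C G : groupType) (j : C -> G) y : {morph j : c d / c * d} ->
  {morph (fun c => y * j c * y^-1) : c d / c * d}.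
Proof. by move=> jM c d; rewrite jM !mulgA mulgVK. Qed.

Lemma conj_inj (C G : groupType) (j : C -> G) y : injective j ->
  injective (fun c => y * j c * y^-1).
Proof. by move=> jI c d /mulIg /mulgI /jI. Qed.

(** * The Bass-Serre graph of an amalgam *)

Section AmalgamTree.
Variables (G C : groupType) (a : amalgam G C).

Let A : set G := range (am_inA a).
Let B : set G := range (am_inB a).
Let C' : set G := range (am_inA a \o am_CA a).
Let T := amalgam_tree a.

Let subA : is_subgroup A. Proof. exact/subgroup_range/gmulfM. Qed.
Let subB : is_subgroup B. Proof. exact/subgroup_range/gmulfM. Qed.
Let subC : is_subgroup C'. Proof. exact/subgroup_range/gmulfM. Qed.

(** Take the derivation [d] for the indicator [n] of [C'], and let [z] represent [e]. Colour [gA] by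
    [d g z] and [gB] by [d g z] plus [n (g^-1 * z)]; the ends of [gC'] then differ exactly when
    [gC'] contains [z]. *)
Lemma amalgam_separates (e : edge T) : exists c, separates c e.
Proof.
pose n := bool_of_set C'; have [C1 CM CV] := subC.
have nC g x : C' g -> n (g^-1 * x) = n x.
  move=> Cg; apply: asbool_equiv_eq; split=> Cx; last exact/CM/Cx/CV.
  by rewrite -(mulVKg g x); exact: CM.
have [|d [dM dA dB]] := @amalgam_derivation _ _ a n.
  by move=> c x; apply: nC; exists c.
pose z := coset_rep e.
pose FB g := d g z (+) n (g^-1 * z).
have dA' g h : A h -> d (g * h) z = d g z.
  by move=> [y _ <-]; rewrite dM dA addbF.
have FB' g h : B h -> FB (g * h) = FB g.
  move=> [y _ <-]; rewrite /FB dM dB invgM mulgA -addbA; congr addb.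
  by rewrite addbK.
exists (fun y : vertex T => match y with
  | inl P => d (coset_rep P) z | inr P => FB (coset_rep P) end) => f.
have -> : f = e <-> C' ((coset_rep f)^-1 * z).
  rewrite -(translate_eqP _ _ subC) -!coset_repE.
  by split=> [->//|]; exact: coset_inj.
rewrite /= (coset_rep_const (F := fun g => d g z) subA dA' (coset_mapE _ _)).
rewrite (coset_rep_const (F := FB) subB FB' (coset_mapE _ _)) !mulg1 /FB.
rewrite /n /bool_of_set; split=> [ne|Cf].
  apply: contrapT => nCf; apply: ne; by rewrite asboolF // addbF.
by rewrite asboolT // addbT; case: (d _ _).
Qed.

Let e0 : edge T := coset_base C'.

Let src_e0 : src e0 = inl (coset_base A) :> vertex T.
Proof.
by congr inl; apply: coset_inj; rewrite /= mulset_translate amalgam_absorbA !translate1.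
Qed.

Let tgt_e0 : tgt e0 = inr (coset_base B) :> vertex T.
Proof.
by congr inr; apply: coset_inj; rewrite /= mulset_translate amalgam_absorbB !translate1.
Qed.

Let edgeE (e : edge T) : eact (coset_rep e) e0 = e.
Proof. exact: coset_act_rep. Qed.

(** [A] fixes the source of the base edge and [B] its target, so both move the source within its
    component, and together they generate [G]. *)
Lemma amalgam_connected : connected_graph T.
Proof.
have joined_sym x y : joined x y -> @joined T y x.
  by move=> /joinedP xy; apply/joinedP; exact: path_in_sym.
have joined_trans x y z : joined x y -> joined y z -> @joined T x z.
  by move=> /joinedP xy /joinedP yz; apply/joinedP; exact: path_in_trans yz.
have joined_edge g : joined (vact g (src e0)) (@vact G T g (tgt e0)).
  apply/joinedP/path_in_step => //; exists (eact g e0).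
  by left; rewrite src_eact tgt_eact.
have fixA y : vact (am_inA a y) (src e0) = src e0 :> vertex T.
  by rewrite src_e0; congr inl; apply: coset_base_fix => //; exists y.
have fixB y : vact (am_inB a y) (tgt e0) = tgt e0 :> vertex T.
  by rewrite tgt_e0; congr inr; apply: coset_base_fix => //; exists y.
have orbit g : joined (src e0) (@vact G T g (src e0)).
  apply: (amalgam_generated (a := a) (subgroup_joined (src e0 : vertex T))) => y.
    by rewrite /mkset fixA; exists 0; exact: walk_nil.
  apply: joined_trans (joined_sym _ _ (joined_edge (am_inB a y))).
  by rewrite fixB; have := joined_edge 1; rewrite !vact1.
suff all x : joined (src e0) x.
  by move=> x y; apply: joined_trans (all y); exact/joined_sym/all.
case: x => P.
  by have := orbit (coset_rep P); rewrite {2}src_e0 /= coset_act_rep.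
have := joined_trans _ _ _ (orbit (coset_rep P)) (joined_edge (coset_rep P)).
by rewrite tgt_e0 /= coset_act_rep.
Qed.

(** Elements of [A] and [B] outside [C] fix one end of the base edge and move the edge, because the
    vertex groups embed; conjugation by [z] carries this to [e]. *)
Lemma amalgam_movable (e : edge T) : movable e.
Proof.
left; have [injA injB] := amalgam_inj a.
have [x nx] : exists x, ~ range (am_CA a) x.
  by apply/existsNP => all; apply: (@am_CA_proper _ _ a); apply/seteqP;
    split=> // z _; exact: all.
have [y ny] : exists y, ~ range (am_CB a) y.
  by apply/existsNP => all; apply: (@am_CB_proper _ _ a); apply/seteqP;
    split=> // z _; exact: all.
set z := coset_rep e.
exists (z * am_inA a x * z^-1), (z * am_inB a y * z^-1); split.
- rewrite -{1 2}(edgeE e) src_eact -!vactM mulgVK vactM src_e0 /= coset_base_fix //.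
- apply: (coset_conj_moves subC) => -[c _ /injA cx]; apply: nx; by exists c.
- rewrite -{1 2}(edgeE e) tgt_eact -!vactM mulgVK vactM tgt_e0 /= coset_base_fix //.
- apply: (coset_conj_moves subC) => -[c _]; rewrite /= am_comm => /injB cy.
  by apply: ny; exists c.
Qed.

(** Here [j] is the embedding of [C] conjugated by the representative of [e]; its image is the
    stabilizer of [e]. *)
Lemma amalgam_one_ended_halfspaces :
  one_ended_group G -> two_ended_group C -> one_ended_halfspaces T.
Proof.
move=> oneG twoC v S admS e h eh; have [c ce] := amalgam_separates e.
apply: (@one_ended_halfspace _ T amalgam_connected _ _ _ _ ce _ v S h _ _
  oneG twoC (amalgam_movable e) admS eh).
- by move=> g; exact: coset_stabilizer.
- exact/conj_morph/gmulfM.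
- apply: conj_inj; apply: inj_comp (@am_CA_inj _ _ a).
  by have [] := amalgam_inj a.
Qed.

End AmalgamTree.

(** * The Bass-Serre graph of an HNN extension *)

Section HnnTree.
Variables (G C : groupType) (a : hnn G C).

Let A : set G := range (hnn_in a).
Let C' : set G := range (hnn_in a \o hnn_alpha a).
Let T := hnn_tree a.

Let subA : is_subgroup A. Proof. exact/subgroup_range/gmulfM. Qed.
Let subC : is_subgroup C'. Proof. exact/subgroup_range/gmulfM. Qed.

(** Colour [gA] by [d g z], where [d] vanishes on [A] and takes the indicator [n] of [C'] at
    [hnn_t]. Across [gC'] the colour changes by [n (g^-1 * z)]. *)
Lemma hnn_separates (e : edge T) : exists c, separates c e.
Proof.
pose n := bool_of_set C'; have [C1 CM CV] := subC.
have nC g x : C' g -> n (g^-1 * x) = n x.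
  move=> Cg; apply: asbool_equiv_eq; split=> Cx; last exact/CM/Cx/CV.
  by rewrite -(mulVKg g x); exact: CM.
have [|d [dM dA dt]] := @hnn_derivation _ _ a n.
  by move=> c x; apply: nC; exists c.
pose z := coset_rep e.
have dA' g h : A h -> d (g * h) z = d g z.
  by move=> [y _ <-]; rewrite dM dA addbF.
exists (fun P : vertex T => d (coset_rep P) z) => f.
have -> : f = e <-> C' ((coset_rep f)^-1 * z).
  rewrite -(translate_eqP _ _ subC) -!coset_repE.
  by split=> [->//|]; exact: coset_inj.
rewrite /= !(coset_rep_const (F := fun g => d g z) subA dA' (coset_mapE _ _)).
rewrite mulg1 dM dt /n /bool_of_set; split=> [ne|Cf].
  by apply: contrapT => nCf; apply: ne; rewrite asboolF // addbF.
by rewrite asboolT // addbT; case: (d _ _).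
Qed.

Let e0 : edge T := coset_base C'.

Let src_e0 : src e0 = coset_base A :> vertex T.
Proof.
by apply: coset_inj; rewrite /= mulset_translate hnn_absorb_src !translate1.
Qed.

Let tgt_e0 : tgt e0 = vact (hnn_t a) (src e0) :> vertex T.
Proof.
rewrite src_e0; apply: coset_inj.
by rewrite /= mulset_translate hnn_absorb_tgt !translate1.
Qed.

Let edgeE (e : edge T) : eact (coset_rep e) e0 = e.
Proof. exact: coset_act_rep. Qed.

Let vertexE (x : vertex T) : vact (coset_rep x) (src e0) = x.
Proof. by rewrite src_e0; exact: coset_act_rep. Qed.

(** [A] fixes the base vertex and [hnn_t] moves it along the base edge; together they generate [G],
    which is transitive on vertices. *)
Lemma hnn_connected : connected_graph T.
Proof.
have fixA y : vact (hnn_in a y) (src e0) = src e0 :> vertex T.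
  by rewrite src_e0; apply: coset_base_fix => //; exists y.
have all g : joined (src e0) (@vact G T g (src e0)).
  apply: (hnn_generated (a := a) (subgroup_joined (src e0 : vertex T))) => [y|].
    by rewrite /mkset fixA; exists 0; exact: walk_nil.
  by rewrite /mkset -tgt_e0; apply/joinedP/path_in_step => //; exists e0; left.
move=> x y; have /joinedP xx := all (coset_rep x).
have /joinedP yy := all (coset_rep y); apply/joinedP.
by move: xx yy; rewrite !vertexE => /path_in_sym; exact: path_in_trans.
Qed.

Lemma hnn_movable (e : edge T) : movable e.
Proof.
right; set z := coset_rep e; split.
  exists (z * hnn_t a * z^-1).
  by rewrite -(edgeE e) src_eact tgt_eact -vactM mulgVK vactM tgt_e0.
move=> x; exists (z * (coset_rep x)^-1).
by rewrite -(edgeE e) src_eact vactM -{2}(vertexE x) vactK.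
Qed.

Lemma hnn_one_ended_halfspaces :
  one_ended_group G -> two_ended_group C -> one_ended_halfspaces T.
Proof.
move=> oneG twoC v S admS e h eh; have [c ce] := hnn_separates e.
apply: (@one_ended_halfspace _ T hnn_connected _ _ _ _ ce _ v S h _ _
  oneG twoC (hnn_movable e) admS eh).
- by move=> g; exact: coset_stabilizer.
- exact/conj_morph/gmulfM.
- exact/conj_inj/inj_comp/(@hnn_alpha_inj _ _ a)/hnn_inj.
Qed.

End HnnTree.

Theorem corollary1p2 (G C : groupType) (s : splitting G C) :
  one_ended_group G -> two_ended_group C ->
  one_ended_halfspaces (bass_serre_tree s).
Proof.
by case: s => a; [exact: amalgam_one_ended_halfspaces|exact: hnn_one_ended_halfspaces].
Qed.
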